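(* Let $p$ be an odd prime, $q=p^m$, and let \[\ell(x)=\sum_{i=0}^{m-1}\sum_{j=0}^2b_{ij}x^{p^iq^j}\] with coefficients $b_{ij}\in\mathbb F_{q^3}$. Let $a\in\mathbb F_{q^3}^*$. Then the function $f(x)=\mathrm{Tr}(ax^{q+1})+\ell(x^2)$ is a planar function on $\mathbb F_{q^3}$ if and only if $\ell$ induces a permutation of $\mathbb F_{q^3}$ and, for each $i\in\{0,\dots,m-1\}$, \[\sum_{j=0}^2b_{ij}a^{2p^iq^{j+1}}=\begin{cases}0&\text{if }i\ne0,\\\mathrm N(a)&\text{if }i=0.\end{cases}\]
   Context: $\mathrm{Tr}$ and $\mathrm N$ denote the trace and norm from $\mathbb F_{q^3}$ to $\mathbb F_q$: $\mathrm{Tr}(y)=y+y^q+y^{q^2}$, $\mathrm N(y)=y^{1+q+q^2}$. A function $f$ on $\mathbb F_{q^n}$ is planar if for every $c\in\mathbb F_{q^n}^*$ the map $x\mapsto f(x+c)-f(x)$ is a permutation of $\mathbb F_{q^n}$. *)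

(* Defs.v *)
From HB Require Import structures.
From mathcomp Require Import all_boot all_order all_algebra all_field.
Set Implicit Arguments. Unset Strict Implicit. Unset Printing Implicit Defensive.
Import GRing.Theory.
Local Open Scope ring_scope.

(* F plays the role of F_{q^3}; q is passed explicitly. *)

Definition Tr3 (F : finFieldType) (q : nat) (y : F) : F :=
  y + y ^+ q + y ^+ (q ^ 2)%N.

Definition N3 (F : finFieldType) (q : nat) (y : F) : F :=
  y ^+ (1 + q + q ^ 2)%N.

Definition planar (F : finFieldType) (f : F -> F) : Prop :=
  forall c : F, c != 0 -> bijective (fun x => f (x + c) - f x).

Definition linpoly (F : finFieldType) (p m : nat) (b : 'I_m -> 'I_3 -> F)
    (x : F) : F :=
  \sum_(i < m) \sum_(j < 3) b i j * x ^+ (p ^ i * (p ^ m) ^ j)%N.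

(* Main.v *)
Require Import Defs.
From HB Require Import structures.
From mathcomp Require Import all_boot all_order all_algebra all_field.
From mathcomp Require Import ring zify.
Import GRing.Theory.
Local Open Scope ring_scope.

(** Substituting x = a^q w and c = a^q z, planarity says that
    Tr(w) Tr(z) - Tr(wz) + 2 l'(wz) never vanishes for w, z <> 0, where
    l'(y) = l(a^(2q) y) / N(a), and the coefficient conditions say that l' is the identity on F_q.
    If they hold, a zero has e = wz in F_q and Tr(w) Tr(1/w) = 1, that is
    (w + w^q)(w^q + w^(q^2))(w^(q^2) + w) = 0, which is absurd in odd characteristic.
    Conversely, if y <> 0 and l'(y) lies in F_q, then the plane cubic Tr(w) Tr(y/w) = r with
    r = Tr(y) - 2 l'(y) has no F_q-rational point, and this forces y in F_q and r = y, so that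
    l'(y) = y.  As the y with l'(y) in F_q form a group of order at least q, l' is the identity on F_q.

    Let C be a cubic Tr(w) Tr(y/w) = r without F_q-points, with y outside F_q; in the coordinates
    X_i = w^(q^(i-1)) it is (X1 + X2 + X3)(y1/X1 + y2/X2 + y3/X3) = r, and Frobenius is
    phi(X1, X2, X3) = (X3^q, X1^q, X2^q).  The involution X_i -> y_i/X_i of C is the translation by
    a 2-torsion class, hence the tangents at P and at its image P' meet C again at the same point,
    and the quotient f(P, Q) of the two tangents evaluated at Q has its only pole, a double one, at
    Q = P.  Since phi P <> P on C, the function f(P, phi P) is regular, hence constant: the minors
    of (P, phi P) generate all forms of high degree d modulo the cubic, so f(P, phi P) acts on the
    finite set of forms of degree d, and after subtracting its value at one point it acts
    injectively but not surjectively unless it vanishes.  Its values at (0,1,0) and (-1,1,0) are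
    y2 y3 and y1 y3, so y1 = y2, that is y = y^q, a contradiction. *)

(** * The ring A[sqrt k] *)

(* (a, b) stands for a + b sqrt k. *)
Definition quad (A : comNzRingType) (k : A) : Type := (A * A)%type.

Section Quad.
Variables (A : comNzRingType) (k : A).
Local Notation Q := (quad A k).

HB.instance Definition _ := GRing.Zmodule.copy Q (A * A)%type.

Definition quad_one : Q := (1, 0).
Definition quad_mul (z w : Q) : Q :=
  (z.1 * w.1 + k * (z.2 * w.2), z.1 * w.2 + z.2 * w.1).

Fact quad_mulA : associative quad_mul.
Proof. by move=> [a b] [c d] [e f]; congr pair => /=; ring. Qed.
Fact quad_mulC : commutative quad_mul.
Proof. by move=> [a b] [c d]; congr pair => /=; ring. Qed.
Fact quad_mul1 : left_id quad_one quad_mul.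
Proof. by move=> [a b]; congr pair => /=; ring. Qed.
Fact quad_mulD : left_distributive quad_mul +%R.
Proof. by move=> [a b] [c d] [e f]; congr pair => /=; ring. Qed.
Fact quad_one_neq0 : quad_one != 0.
Proof. by apply/eqP => -[/eqP]; rewrite oner_eq0. Qed.

HB.instance Definition _ := GRing.Zmodule_isComNzRing.Build Q
  quad_mulA quad_mulC quad_mul1 quad_mulD quad_one_neq0.

Definition quadC (a : A) : Q := (a, 0).
Definition quad_sqrt : Q := (0, 1).

Fact quadC_zmod : zmod_morphism quadC.
Proof. by move=> a b; congr pair => /=; rewrite subrr. Qed.
Fact quadC_monoid : monoid_morphism quadC.
Proof. by split=> // a b; congr pair => /=; ring. Qed.
HB.instance Definition _ := GRing.isZmodMorphism.Build A Q quadC quadC_zmod.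
HB.instance Definition _ := GRing.isMonoidMorphism.Build A Q quadC quadC_monoid.

Lemma quad_sqrtK : quad_sqrt ^+ 2 = quadC k.
Proof. by rewrite expr2; congr pair => /=; ring. Qed.

Section Eval.
Variables (B : comNzRingType) (e : {rmorphism A -> B}) (v : B).
Hypothesis hv : v ^+ 2 = e k.

(** The proof is an argument, so that the morphism instances, which depend on it, attach to the
    function itself. *)
Definition quad_eval of v ^+ 2 = e k := fun z : Q => e z.1 + e z.2 * v.

Fact quad_eval_zmod : zmod_morphism (quad_eval hv).
Proof. by move=> [a b] [c d]; rewrite /quad_eval /= !rmorphB; ring. Qed.
Fact quad_eval_monoid : monoid_morphism (quad_eval hv).
Proof.
split=> [|[a b] [c d]]; rewrite /quad_eval /= ?rmorph1 ?rmorph0; first by ring.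
by rewrite !rmorphD !rmorphM -hv; ring.
Qed.
HB.instance Definition _ := GRing.isZmodMorphism.Build Q B _ quad_eval_zmod.
HB.instance Definition _ := GRing.isMonoidMorphism.Build Q B _ quad_eval_monoid.

Lemma quad_evalC a : quad_eval hv (quadC a) = e a.
Proof. by rewrite /quad_eval /= rmorph0 mul0r addr0. Qed.
Lemma quad_eval_sqrt : quad_eval hv quad_sqrt = v.
Proof. by rewrite /quad_eval /= rmorph0 rmorph1 mul1r add0r. Qed.
End Eval.
End Quad.

(** The norm a^2 - k b^2 is multiplicative and vanishes only at 0: if a^2 = k b^2 with b <> 0, then
    b divides a and k is the square of a / b. *)
Lemma quad_domain (F : fieldType) (k : {poly F}) :
  (forall r, k != r ^+ 2) ->
  forall z w : quad {poly F} k, z * w = 0 -> z = 0 \/ w = 0.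
Proof.
move=> nsq.
have norm0 (a b : {poly F}) : a ^+ 2 = k * b ^+ 2 -> b = 0.
  move=> ab; apply/eqP; apply: contraT => b0.
  have /dvdpP[r ra] : b %| a by rewrite -(dvdp_pexp2r b a (isT : 0 < 2)%N) ab dvdp_mull.
  move: ab; rewrite ra exprMn => /(mulIf (expf_neq0 2 b0)) rk.
  by have := nsq r; rewrite rk eqxx.
have norm00 (a b : {poly F}) : a ^+ 2 - k * b ^+ 2 = 0 -> (a, b) = 0 :> quad _ k.
  move/eqP; rewrite subr_eq0 => /eqP ab; have b0 := norm0 _ _ ab.
  by move/eqP: ab; rewrite b0 expr0n mulr0 expf_eq0 /= => /eqP ->.
move=> [a b] [c d] zw.
have /eqP : (a ^+ 2 - k * b ^+ 2) * (c ^+ 2 - k * d ^+ 2) = 0.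
  have [h1 h2] : (a * c + k * (b * d) = 0) /\ (a * d + b * c = 0).
    by case: zw => -> ->.
  transitivity ((a * c + k * (b * d)) ^+ 2 - k * (a * d + b * c) ^+ 2); first by ring.
  by rewrite h1 h2; ring.
by rewrite mulf_eq0 => /orP[] /eqP /norm00; [left|right].
Qed.

(** * Forms modulo the minors of a point and its Frobenius image *)

Section Forms.
Variables (L : finFieldType) (R : comNzRingType) (iota : {rmorphism L -> R}).
Variables x1 x2 x3 : R.

(* The values at (x1, x2, x3) of the forms of degree d over L. *)
Fixpoint forms (d : nat) : seq R :=
  if d is e.+1 then
    [seq x1 * a + (x2 * bc.1 + x3 * bc.2)
       | a <- forms e, bc <- [seq (b, c) | b <- forms e, c <- forms e]]
  else [seq iota c | c <- enum L].

Lemma formsSP d v :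
  reflect (exists a b c, [/\ a \in forms d, b \in forms d, c \in forms d
                           & v = x1 * a + x2 * b + x3 * c])
          (v \in forms d.+1).
Proof.
apply: (iffP allpairsP) => [[[a [b c]] /= [ha /allpairsP[[b' c'] /= [hb hc [-> ->]]] ->]]|].
  by exists a, b', c'; rewrite addrA.
case=> a [b [c [ha hb hc ->]]]; exists (a, (b, c)); split => //=; last by rewrite addrA.
by apply/allpairsP; exists (b, c).
Qed.

Lemma forms_const c : iota c \in forms 0.
Proof. by apply: map_f; rewrite mem_enum. Qed.

Lemma forms0P v : v \in forms 0 -> exists c, v = iota c.
Proof. by case/mapP => c _ ->; exists c. Qed.

Lemma formsD d v w : v \in forms d -> w \in forms d -> v + w \in forms d.
Proof.
elim: d v w => [|d IH] v w.
  by move=> /forms0P[c ->] /forms0P[c' ->]; rewrite -rmorphD forms_const.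
move=> /formsSP[a [b [c [ha hb hc ->]]]] /formsSP[a' [b' [c' [ha' hb' hc' ->]]]].
by apply/formsSP; exists (a + a'), (b + b'), (c + c'); split; rewrite ?IH //; ring.
Qed.

Lemma formsZ d k v : v \in forms d -> iota k * v \in forms d.
Proof.
elim: d v => [|d IH] v.
  by move=> /forms0P[c ->]; rewrite -rmorphM forms_const.
move=> /formsSP[a [b [c [ha hb hc ->]]]].
by apply/formsSP; exists (iota k * a), (iota k * b), (iota k * c); split; rewrite ?IH //; ring.
Qed.

Lemma formsN d v : v \in forms d -> - v \in forms d.
Proof. by move=> hv; rewrite -mulN1r -(rmorphN1 iota) formsZ. Qed.

Lemma formsB d v w : v \in forms d -> w \in forms d -> v - w \in forms d.
Proof. by move=> hv hw; rewrite formsD ?formsN. Qed.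

Lemma forms0 d : 0 \in forms d.
Proof.
elim: d => [|d IH]; first by rewrite -(rmorph0 iota) forms_const.
by apply/formsSP; exists 0, 0, 0; split=> //; rewrite !mulr0 !addr0.
Qed.

Lemma forms_x1 d v : v \in forms d -> x1 * v \in forms d.+1.
Proof. by move=> hv; apply/formsSP; exists v, 0, 0; rewrite !forms0; split=> //; ring. Qed.
Lemma forms_x2 d v : v \in forms d -> x2 * v \in forms d.+1.
Proof. by move=> hv; apply/formsSP; exists 0, v, 0; rewrite !forms0; split=> //; ring. Qed.
Lemma forms_x3 d v : v \in forms d -> x3 * v \in forms d.+1.
Proof. by move=> hv; apply/formsSP; exists 0, 0, v; rewrite !forms0; split=> //; ring. Qed.

Lemma formsM d e n v w : v \in forms d -> w \in forms e -> n = (d + e)%N ->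
  v * w \in forms n.
Proof.
move=> hv hw ->; elim: d v hv => [|d IH] v.
  by move=> /forms0P[c ->]; rewrite formsZ.
move=> /formsSP[a [b [c [ha hb hc ->]]]]; rewrite !mulrDl -!mulrA addSn.
by rewrite !formsD ?forms_x1 ?forms_x2 ?forms_x3 ?IH.
Qed.

Lemma formsX d n v : v \in forms d -> v ^+ n \in forms (n * d).
Proof.
move=> hv; elim: n => [|n IH]; first by rewrite expr0 -(rmorph1 iota) forms_const.
by rewrite exprS; apply: formsM hv IH _; rewrite mulSn.
Qed.

Definition mon a b c : R := x1 ^+ a * x2 ^+ b * x3 ^+ c.

Lemma forms1 : [/\ x1 \in forms 1, x2 \in forms 1 & x3 \in forms 1].
Proof.
have h := forms_const 1; rewrite rmorph1 in h.
by split; rewrite -1?[X in X \in _]mulr1; [apply: forms_x1|apply: forms_x2|apply: forms_x3].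
Qed.

Lemma forms_mon a b c n : n = (a + b + c)%N -> mon a b c \in forms n.
Proof.
have [h1 h2 h3] := forms1; move=> ->.
apply: (formsM (a * 1 + b * 1) (c * 1)); rewrite ?formsX //; last by rewrite !muln1.
by apply: (formsM (a * 1) (b * 1)); rewrite ?formsX.
Qed.

Lemma forms_ind (P : R -> Prop) d v :
  (forall v w, P v -> P w -> P (v + w)) -> (forall k v, P v -> P (iota k * v)) ->
  (forall a b c, (a + b + c)%N = d -> P (mon a b c)) ->
  v \in forms d -> P v.
Proof.
elim: d P v => [|d IH] P v hD hZ hM.
  move=> /forms0P[c ->]; rewrite -[iota c]mulr1; apply: hZ.
  by have := hM 0%N 0%N 0%N erefl; rewrite /mon !expr0 !mulr1.
have hs (x : R) : (forall a b c, (a + b + c)%N = d -> P (x * mon a b c)) ->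
    forall v, v \in forms d -> P (x * v).
  move=> hx w; apply: (IH (fun v => P (x * v))) => // [u w' hu hw|k u hu].
    by rewrite mulrDr; apply: hD.
  by rewrite mulrCA; apply: hZ.
move=> /formsSP[a [b [c [ha hb hc ->]]]]; apply: (hD); first apply: (hD).
- apply: hs ha => i j k ijk; have -> : x1 * mon i j k = mon i.+1 j k.
    by rewrite /mon exprS; ring.
  by apply: hM; lia.
- apply: hs hb => i j k ijk; have -> : x2 * mon i j k = mon i j.+1 k.
    by rewrite /mon exprS; ring.
  by apply: hM; lia.
- apply: hs hc => i j k ijk; have -> : x3 * mon i j k = mon i j k.+1.
    by rewrite /mon exprS; ring.
  by apply: hM; lia.
Qed.

Variable q : nat.
Hypothesis q_gt1 : (1 < q)%N.

(* The minors of (x1, x2, x3) and (x3 ^+ q, x1 ^+ q, x2 ^+ q); [in_minors e] is the part of degree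
   e + q + 1 of the ideal they generate. *)
Definition minor1 := x2 ^+ q.+1 - x3 * x1 ^+ q.
Definition minor2 := x3 ^+ q.+1 - x1 * x2 ^+ q.
Definition minor3 := x1 ^+ q.+1 - x2 * x3 ^+ q.

Definition in_minors e v := exists a b c, [/\ a \in forms e, b \in forms e, c \in forms e
  & v = minor1 * a + minor2 * b + minor3 * c].

Lemma in_minors0 e : in_minors e 0.
Proof. by exists 0, 0, 0; rewrite forms0 !mulr0 !addr0. Qed.
Lemma in_minorsD e v w : in_minors e v -> in_minors e w -> in_minors e (v + w).
Proof.
move=> [a [b [c [ha hb hc ->]]]] [a' [b' [c' [ha' hb' hc' ->]]]].
by exists (a + a'), (b + b'), (c + c'); split; rewrite ?formsD //; ring.
Qed.
Lemma in_minorsZ e k v : in_minors e v -> in_minors e (iota k * v).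
Proof.
move=> [a [b [c [ha hb hc ->]]]].
by exists (iota k * a), (iota k * b), (iota k * c); split; rewrite ?formsZ //; ring.
Qed.
Lemma in_minorsN e v : in_minors e v -> in_minors e (- v).
Proof. by move=> hv; rewrite -mulN1r -(rmorphN1 iota); apply: in_minorsZ. Qed.
Lemma in_minors1 e a : a \in forms e -> in_minors e (minor1 * a).
Proof. by move=> ha; exists a, 0, 0; rewrite ha forms0; split=> //; ring. Qed.
Lemma in_minors2 e a : a \in forms e -> in_minors e (minor2 * a).
Proof. by move=> ha; exists 0, a, 0; rewrite ha forms0; split=> //; ring. Qed.
Lemma in_minors3 e a : a \in forms e -> in_minors e (minor3 * a).
Proof. by move=> ha; exists 0, 0, a; rewrite ha forms0; split=> //; ring. Qed.

(* Modulo the minors, x1^(q+1), x2^(q+1) and x1 x2^q can be rewritten so as to lower the exponents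
   of x1 and x2.  The remaining monomials x1^a x2^b x3^c are indexed by j = a q + (q - 1 - b); this
   covers x2^q x3^q in the form of the congruent x1^(q+1) x2^(q-1). *)
Definition nexp1 j := (j %/ q)%N.
Definition nexp2 j := (q.-1 - j %% q)%N.
Definition nmon d j := mon (nexp1 j) (nexp2 j) (d - nexp1 j - nexp2 j).
(* The exponent of t in the monomial evaluated at (t, t ^+ q, t ^+ (q ^ 2)). *)
Definition wt (a b c : nat) := (a + b * q + c * q ^ 2)%N.
Definition nwt d j := wt (nexp1 j) (nexp2 j) (d - nexp1 j - nexp2 j).

Lemma mon_step1 a b c e : (a + b + c = e)%N ->
  in_minors e (mon a (b + q.+1) c - mon (a + q) b c.+1).
Proof.
move=> abc; have -> : mon a (b + q.+1) c - mon (a + q) b c.+1 = minor1 * mon a b c.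
  by rewrite /mon /minor1 !exprD !exprS; ring.
by apply: in_minors1; apply: forms_mon.
Qed.
Lemma mon_step2 a b c e : (a + b + c = e)%N ->
  in_minors e (mon a b (c + q.+1) - mon a.+1 (b + q) c).
Proof.
move=> abc; have -> : mon a b (c + q.+1) - mon a.+1 (b + q) c = minor2 * mon a b c.
  by rewrite /mon /minor2 !exprD !exprS; ring.
by apply: in_minors2; apply: forms_mon.
Qed.
Lemma mon_step3 a b c e : (a + b + c = e)%N ->
  in_minors e (mon (a + q.+1) b c - mon a b.+1 (c + q)).
Proof.
move=> abc; have -> : mon (a + q.+1) b c - mon a b.+1 (c + q) = minor3 * mon a b c.
  by rewrite /mon /minor3 !exprD !exprS; ring.
by apply: in_minors3; apply: forms_mon.
Qed.

Hypothesis cardL : #|L| = (q ^ 3)%N.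

Lemma exprq3 (t : L) : t ^+ (q ^ 3) = t.
Proof. by rewrite -cardL expf_card. Qed.

Lemma expr_wt (t : L) a b c : t ^+ wt a b c = t ^+ a * (t ^+ q) ^+ b * (t ^+ (q ^ 2)) ^+ c.
Proof. by rewrite /wt !exprD -!exprM (mulnC b) (mulnC c). Qed.

(** Induction on a + b along the three rewritings. They also preserve the value at (t, t^q,
    t^(q^2)), where the minors vanish because t^(q^3) = t. *)
Lemma mon_congr_nmon e a b c : (q.-1 <= e)%N -> (a + b + c = e + q.+1)%N ->
  exists j : 'I_(q ^ 2 + q + 1), in_minors e (mon a b c - nmon (e + q.+1) j) /\
    forall t : L, t ^+ wt a b c = t ^+ nwt (e + q.+1) j.
Proof.
move=> he; have [n abn] := ubnP (a + b)%N; elim: n => // n IH in a b c abn *.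
move=> abc.
have trans a' b' c' : (a' + b' < a + b)%N -> (a' + b' + c' = e + q.+1)%N ->
    in_minors e (mon a b c - mon a' b' c') -> (forall t : L, t ^+ wt a b c = t ^+ wt a' b' c') ->
    exists j : 'I_(q ^ 2 + q + 1), in_minors e (mon a b c - nmon (e + q.+1) j) /\
    forall t : L, t ^+ wt a b c = t ^+ nwt (e + q.+1) j.
  move=> lt' abc' hI ht; case: (IH a' b' c') => // [|j [hj htj]]; first lia.
  exists j; split=> [|t]; last by rewrite ht htj.
  by rewrite -(subrK (mon a' b' c') (mon a b c)) -addrA; apply: in_minorsD.
have cube (t : L) : ((t ^+ q) ^+ q = t ^+ (q ^ 2)) * ((t ^+ (q ^ 2)) ^+ q = t).
  by rewrite -!exprM -{4}(exprq3 t) -!expnSr.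
have [a_le|a_gt] := leqP a q; last first.
  apply: (trans (a - q.+1)%N b.+1 (c + q)%N); try lia.
    by have -> : mon a b c = mon (a - q.+1 + q.+1) b c; [congr mon; lia|apply: mon_step3; lia].
  move=> t; have {1}-> : a = (a - q.+1 + q.+1)%N by lia.
  rewrite !expr_wt !exprD !exprS !cube; ring.
have [b_le|b_gt] := leqP b q; last first.
  apply: (trans (a + q)%N (b - q.+1)%N c.+1); try lia.
    by have -> : mon a b c = mon a (b - q.+1 + q.+1) c; [congr mon; lia|apply: mon_step1; lia].
  move=> t; have {1}-> : b = (b - q.+1 + q.+1)%N by lia.
  rewrite !expr_wt !exprD !exprS !cube; ring.
have [b_lt|b_ge] := ltnP b q.
  have lt_j : (a * q + (q.-1 - b) < q ^ 2 + q + 1)%N by nia.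
  exists (Ordinal lt_j).
  have nae : nexp1 (Ordinal lt_j) = a by rewrite /nexp1 /= divnMDl; [rewrite divn_small; lia|lia].
  have nbe : nexp2 (Ordinal lt_j) = b by rewrite /nexp2 /= modnMDl modn_small; lia.
  rewrite /nmon /nwt nae nbe; have -> : (e + q.+1 - a - b = c)%N by lia.
  by rewrite subrr; split=> //; apply: in_minors0.
have be : b = q by lia.
case: a => [|a] in a_le abn abc trans *; last first.
  apply: (trans a 0%N (c + q.+1)%N); try lia.
    rewrite -opprB; apply: in_minorsN; rewrite be.
    by apply: (mon_step2 a 0 c); lia.
  move=> t; rewrite be !expr_wt !exprD !exprS !cube; ring.
(* For x2^q x3^c the bound q - 1 <= e gives c >= q, so [mon_step3] backwards leads to x1^(q+1)
   x2^(q-1) x3^(c-q), whose index is the last one, q^2 + q. *)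
have lt_j : (q.+1 * q < q ^ 2 + q + 1)%N by nia.
exists (Ordinal lt_j).
have nae : nexp1 (Ordinal lt_j) = q.+1 by rewrite /nexp1 /= mulnK; lia.
have nbe : nexp2 (Ordinal lt_j) = q.-1 by rewrite /nexp2 /= modnMl subn0.
rewrite /nmon /nwt nae nbe; set c' := (_ - _ - _)%N.
have ce : c = (c' + q)%N by rewrite /c'; lia.
have qe : q = q.-1.+1 by lia.
split=> [|t].
  rewrite be ce -opprB; apply: in_minorsN.
  by have := @mon_step3 0 q.-1 c' e; rewrite add0n -qe; apply; lia.
have qt : (t ^+ q) ^+ q = t ^+ q * (t ^+ q) ^+ q.-1 by rewrite -exprS -qe.
by rewrite !expr_wt be ce !exprD !cube exprS -(cube t).1 qt; ring.
Qed.


Local Notation n0 := (q ^ 2 + q + 1)%N.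
Implicit Types (bt : {ffun 'I_n0 -> L}).

Definition nform d bt : R := \sum_j iota (bt j) * nmon d j.
Definition nfun d bt (t : L) : L := \sum_j bt j * t ^+ nwt d j.

(** Modulo q^3 - 1 the exponent of t is affine in j with slope q (q - 1); the order of the remaining
    monomials is chosen for this. *)
Lemma nwtE d j : (2 * q <= d)%N -> (j < n0)%N ->
  (nwt d j + (nexp1 j * (q ^ 3 - 1) + q * (q - 1) ^ 2) = d * q ^ 2 + q * (q - 1) * j)%N.
Proof.
move=> hd hj; rewrite /nwt /wt.
have jE : j = (nexp1 j * q + j %% q)%N by rewrite /nexp1 -divn_eq.
have lt_r : (j %% q < q)%N by rewrite ltn_mod; lia.
have bE : (j %% q + nexp2 j = q.-1)%N by rewrite /nexp2; lia.
have a_le : (nexp1 j <= q.+1)%N by rewrite /nexp1 -ltnS ltn_divLR; nia.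
move: (nexp1 j) (nexp2 j) (j %% q)%N jE lt_r bE a_le => a b r -> lt_r bE a_le.
have [c cE] : exists c, d = (a + b + c)%N by exists (d - a - b)%N; lia.
have -> : (d - a - b = c)%N by lia.
have -> : q = (b + r).+1 by lia.
by rewrite cE -[((b + r).+1 ^ 3)%N]prednK ?expn_gt0 // subn1 subSS subn0 /=; nia.
Qed.

(** By [nwtE], at s with s^q = t the function is, up to powers of s, a polynomial in t of degree at
    most (q - 1)(q^2 + q) = q^3 - q, too small for q^3 - 1 nonzero roots. *)
Lemma nfun_inj d bt : (2 * q <= d)%N -> (forall t, t != 0 -> nfun d bt t = 0) ->
  forall j, bt j = 0.
Proof.
move=> hd h; pose P := \sum_j bt j *: 'X^((q - 1) * j) : {poly L}.
have P0 : P = 0.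
  apply/eqP/contraT => Pn0.
  have size_P : (size P <= q ^ 3 - 1)%N.
    apply: (leq_trans (size_sum _ _ _)); apply/bigmax_leqP => j _.
    apply: leq_trans (size_scale_leq _ _) _; rewrite size_polyXn.
    by have := ltn_ord j; nia.
  pose rs := [seq t <- enum L | t != 0].
  have : (size rs < size P)%N.
    apply: max_poly_roots => //; last by rewrite filter_uniq ?enum_uniq.
    apply/allP => t; rewrite mem_filter => /andP[tn0 _].
    have [s st] : exists s, s ^+ q = t.
      by exists (t ^+ (q ^ 2)); rewrite -exprM -expnSr exprq3.
    have sn0 : s != 0 by apply: contraNneq tn0 => s0; rewrite -st s0 expr0n; case: (q) q_gt1.
    have := h s sn0; move/(congr1 (fun z => z * s ^+ (q * (q - 1) ^ 2))).
    rewrite mul0r /nfun mulr_suml.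
    under eq_bigr => j _.
      have e1 : s ^+ (nexp1 j * (q ^ 3 - 1)) = 1.
        rewrite mulnC exprM subn1 (_ : s ^+ (q ^ 3).-1 = 1) ?expr1n //.
        apply: (mulfI sn0); rewrite mulr1 -exprS prednK ?exprq3 //.
        by rewrite expn_gt0; lia.
      rewrite -mulrA -[s ^+ (q * _)]mul1r -e1 -exprD -exprD (nwtE _ _ hd (ltn_ord j)).
      rewrite exprD mulrCA -(mulnA q) (exprM s q) st.
      over.
    rewrite -mulr_sumr => /eqP; rewrite mulf_eq0 expf_eq0 (negPf sn0) andbF /= => hs.
    rewrite /root horner_sum; apply: etrans hs; congr (_ == 0); apply: eq_bigr => j _.
    by rewrite hornerZ hornerXn.
  have -> : size rs = (q ^ 3 - 1)%N.
    by rewrite -cardL subn1 -(cardC1 (0 : L)) cardE /enum_mem -enumT.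
  by rewrite ltnNge size_P.
move=> j; have := congr1 (fun p : {poly L} => p`_((q - 1) * j)) P0.
rewrite coef0 coef_sum (bigD1 j) //= coefZ coefXn eqxx mulr1 big1 ?addr0 // => i ij.
rewrite coefZ coefXn eqn_pmul2l; last by lia.
by rewrite (inj_eq val_inj) eq_sym (negPf ij) mulr0.
Qed.

Lemma mon_congr_nform e a b c : (q.-1 <= e)%N -> (a + b + c = e + q.+1)%N ->
  exists bt, in_minors e (mon a b c - nform (e + q.+1) bt) /\
    forall t, t ^+ wt a b c = nfun (e + q.+1) bt t.
Proof.
move=> he /(mon_congr_nmon _ _ _ _ he) [j [hj ht]].
exists [ffun i => (i == j)%:R]; split=> [|t].
  rewrite /nform (bigD1 j) //= ffunE eqxx rmorph1 mul1r big1 ?addr0 // => i ij.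
  by rewrite ffunE (negPf ij) rmorph0 mul0r.
rewrite /nfun (bigD1 j) //= ffunE eqxx mul1r big1 ?addr0 // => i ij.
by rewrite ffunE (negPf ij) mul0r.
Qed.

(** A cubic form, listed by coefficients and exponents so that it can be evaluated both in R, where
    it vanishes at (x1, x2, x3), and at (t, t^q, t^(q^2)), where it does not. *)
Variable terms : seq (L * (nat * nat * nat)).
Hypothesis terms_cubic : {in terms, forall m, m.2.1.1 + m.2.1.2 + m.2.2 = 3}%N.
Hypothesis terms_x0 : \sum_(m <- terms) iota m.1 * mon m.2.1.1 m.2.1.2 m.2.2 = 0.
Hypothesis terms_neq0 : forall t : L, t != 0 ->
  \sum_(m <- terms) m.1 * t ^+ wt m.2.1.1 m.2.1.2 m.2.2 != 0.

Lemma nformD d bt bt' : nform d (bt + bt') = nform d bt + nform d bt'.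
Proof. by rewrite /nform -big_split; apply: eq_bigr => j _; rewrite ffunE rmorphD mulrDl. Qed.
Lemma nformZ d k bt : nform d [ffun j => k * bt j] = iota k * nform d bt.
Proof. by rewrite /nform mulr_sumr; apply: eq_bigr => j _; rewrite ffunE rmorphM mulrA. Qed.
Lemma nfunD d bt bt' t : nfun d (bt + bt') t = nfun d bt t + nfun d bt' t.
Proof. by rewrite /nfun -big_split; apply: eq_bigr => j _; rewrite ffunE mulrDl. Qed.
Lemma nfunZ d k bt t : nfun d [ffun j => k * bt j] t = k * nfun d bt t.
Proof. by rewrite /nfun mulr_sumr; apply: eq_bigr => j _; rewrite ffunE mulrA. Qed.

(** The function [g] is carried along with [v] because an element of R does not determine it: the
    cubic is zero in R but not as a function. *)
Lemma sum_congr_nform e (I : eqType) (s : seq I) (v : I -> R) (g : I -> L -> L) :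
  (forall i, i \in s -> exists bt, in_minors e (v i - nform (e + q.+1) bt) /\
     forall t, g i t = nfun (e + q.+1) bt t) ->
  exists bt, in_minors e (\sum_(i <- s) v i - nform (e + q.+1) bt) /\
     forall t, \sum_(i <- s) g i t = nfun (e + q.+1) bt t.
Proof.
elim: s => [|i s IH] h.
  exists 0; split=> [|t]; rewrite big_nil.
    rewrite /nform big1 ?subr0 => [|j _]; first exact: in_minors0.
    by rewrite ffunE rmorph0 mul0r.
  by rewrite /nfun big1 // => j _; rewrite ffunE mul0r.
have [|bt [hbt ht]] := IH; first by move=> k ks; apply: h; rewrite inE ks orbT.
have [|bt' [hbt' ht']] := h i; first by rewrite inE eqxx.
exists (bt' + bt); split=> [|t]; last by rewrite big_cons nfunD ht ht'.
by rewrite big_cons nformD opprD addrACA; apply: in_minorsD.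
Qed.

Lemma scale_congr_nform e v (g : L -> L) k :
  (exists bt, in_minors e (v - nform (e + q.+1) bt) /\ forall t, g t = nfun (e + q.+1) bt t) ->
  exists bt, in_minors e (iota k * v - nform (e + q.+1) bt) /\
     forall t, k * g t = nfun (e + q.+1) bt t.
Proof.
move=> [bt [hbt ht]]; exists [ffun j => k * bt j].
by rewrite nformZ -mulrBr; split=> [|t]; [apply: in_minorsZ|rewrite nfunZ ht].
Qed.

Lemma wtD a b c a' b' c' : wt (a + a') (b + b') (c + c') = (wt a b c + wt a' b' c')%N.
Proof. by rewrite /wt; ring. Qed.
Lemma monD a b c a' b' c' : mon (a + a') (b + b') (c + c') = mon a b c * mon a' b' c'.
Proof. by rewrite /mon !exprD; ring. Qed.

(* Multiplication by the cubic is injective on functions since it has no zero there, hence onto;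
   but the cubic vanishes at (x1, x2, x3). *)
Lemma nform_in_minors e bt : (q.-1 <= e)%N -> in_minors (e + 3) (nform (e + 3 + q.+1) bt).
Proof.
move=> he.
have hmul (bt1 : {ffun 'I_n0 -> L}) : exists bt', in_minors (e + 3) (nform (e + 3 + q.+1) bt') /\
    forall t, (\sum_(m <- terms) m.1 * t ^+ wt m.2.1.1 m.2.1.2 m.2.2) * nfun (e + q.+1) bt1 t
      = nfun (e + 3 + q.+1) bt' t.
  have [|bt' [hbt' ht]] := @sum_congr_nform (e + 3)%N _ terms
    (fun m => iota m.1 * mon m.2.1.1 m.2.1.2 m.2.2 * nform (e + q.+1) bt1)
    (fun m t => m.1 * t ^+ wt m.2.1.1 m.2.1.2 m.2.2 * nfun (e + q.+1) bt1 t).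
    move=> m mF.
    have [|bt' [hbt' ht]] := @sum_congr_nform (e + 3)%N _ (index_enum 'I_n0)
      (fun j => iota m.1 * (iota (bt1 j) * (mon m.2.1.1 m.2.1.2 m.2.2 * nmon (e + q.+1) j)))
      (fun j t => m.1 * (bt1 j * (t ^+ wt m.2.1.1 m.2.1.2 m.2.2 * t ^+ nwt (e + q.+1) j))).
      move=> j _; apply: scale_congr_nform; apply: scale_congr_nform.
      rewrite /nmon /nwt -monD.
      have [||bt' [hbt' ht]] := @mon_congr_nform (e + 3) (m.2.1.1 + nexp1 j) (m.2.1.2 + nexp2 j)
        (m.2.2 + (e + q.+1 - nexp1 j - nexp2 j)).
      - lia.
      - have := terms_cubic _ mF.
        have : (nexp1 j <= q.+1)%N by rewrite /nexp1 -ltnS ltn_divLR; have := ltn_ord j; nia.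
        have : (nexp2 j <= q.-1)%N by rewrite /nexp2; lia.
        move: (nexp1 j) (nexp2 j) => x y; case: m mF => m1 [[m2 m3] m4] /= _; lia.
      by exists bt'; split=> // t; rewrite -ht wtD exprD.
    exists bt'; split=> [|t].
      rewrite [nform (e + q.+1) bt1]/nform mulr_sumr.
      by under eq_bigr do rewrite -mulrA [mon _ _ _ * _]mulrCA.
    by rewrite -ht [nfun (e + q.+1) _ _]/nfun mulr_sumr; apply: eq_bigr => j _; ring.
  exists bt'; split=> [|t]; last by rewrite -ht mulr_suml.
  move: hbt'; rewrite -mulr_suml terms_x0 mul0r sub0r => /in_minorsN; by rewrite opprK.
have [f hf] := fin_all_exists hmul.
have f_inj : injective f.
  move=> b1 b2 fb; apply/ffunP => j; apply/eqP; rewrite -subr_eq0; apply/eqP.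
  have := @nfun_inj (e + q.+1) (b1 - b2); rewrite /= => /(_ _ _ j).
  rewrite !ffunE; apply; first lia.
  move=> t tn0; have [_ /(_ t) e1] := hf b1; have [_ /(_ t) e2] := hf b2.
  apply: (mulfI (terms_neq0 _ tn0)); rewrite mulr0.
  have -> : nfun (e + q.+1) (b1 - b2) t = nfun (e + q.+1) b1 t - nfun (e + q.+1) b2 t.
    by apply/eqP; rewrite eq_sym subr_eq -nfunD subrK.
  by rewrite mulrBr e1 e2 fb subrr.
have /codomP[bt' ->] := injF_onto f_inj bt.
by have [] := hf bt'.
Qed.

(** Geometrically, a point of the cubic is never its own Frobenius image, so the minors have no
    common zero on it. *)
Lemma forms_in_minors e v : (q.-1 <= e)%N -> v \in forms (e + 3 + q.+1) -> in_minors (e + 3) v.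
Proof.
move=> he; apply: forms_ind => [u w|k u|a b c abc].
- exact: in_minorsD.
- exact: in_minorsZ.
have [||bt [hbt _]] := @mon_congr_nform (e + 3) a b c; [lia|by []|].
by rewrite -[mon a b c](subrK (nform (e + 3 + q.+1) bt)); apply: in_minorsD => //; apply: nform_in_minors.
Qed.


Hypothesis domR : forall v w : R, v * w = 0 -> v = 0 \/ w = 0.

Lemma uniq_inj_onto (T : eqType) (s : seq T) (f : T -> T) :
  uniq s -> {in s &, injective f} -> {in s, forall v, f v \in s} ->
  forall w, w \in s -> exists2 v, v \in s & w = f v.
Proof.
move=> us f_inj f_s w ws; apply/mapP.
have sub : {subset map f s <= s} by move=> _ /mapP[v vs ->]; apply: f_s.
have us' : uniq (map f s) by rewrite map_inj_in_uniq.
by have [|_ ->] := uniq_min_size us' sub; rewrite ?size_map.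
Qed.

(* Multiplication by the regular function N/D minus its value at the point given by [ev] maps the
   finite set of forms of degree d into those vanishing at the point; hence it is not injective. *)
Lemma regular_const (D N n11 n22 n33 n12 n13 n23 : R) (ev : {rmorphism R -> L}) :
  all (fun v => v \in forms (2 * q + 2)) [:: n11; n22; n33; n12; n13; n23] ->
  D * n11 = N * (minor1 * minor1) -> D * n22 = N * (minor2 * minor2) -> D * n33 = N * (minor3 * minor3) ->
  D * n12 = N * (minor1 * minor2) -> D * n13 = N * (minor1 * minor3) -> D * n23 = N * (minor2 * minor3) ->
  cancel iota ev -> ev D != 0 -> ev x2 != 0 -> N = iota (ev N / ev D) * D.
Proof.
(* In this degree [forms_in_minors] applies twice, and every form becomes a quadratic expression in
   the minors with coefficients of degree q + 3. *)
pose d := (q + q.+1 + 3 + q.+1)%N.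
have dE : d = (2 * q + 2 + (q + 3))%N by rewrite /d; lia.
have q_le : (q.-1 <= q)%N by rewrite leq_pred.
have q_le' : (q.-1 <= q + q.+1)%N by lia.
move=> /and5P[h11 h22 h33 h12 /and3P[h13 h23 _]] e11 e22 e33 e12 e13 e23 evK evD evx2.
have Dn0 : D <> 0 by move=> D0; rewrite D0 rmorph0 eqxx in evD.
have mulN v : v \in forms d -> exists2 w, w \in forms d & D * w = N * v.
  move=> /(@forms_in_minors (q + q.+1)); case=> //.
  have split e w : e = (q + q.+1 + 3)%N -> w \in forms e -> in_minors (q + 3) w.
    by move=> ->; rewrite addnAC; apply: forms_in_minors.
  move=> a [b [c [/split-/(_ erefl)[a1 [a2 [a3 [ha1 ha2 ha3 ->]]]]
    /split-/(_ erefl)[b1 [b2 [b3 [hb1 hb2 hb3 ->]]]]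
    /split-/(_ erefl)[c1 [c2 [c3 [hc1 hc2 hc3 ->]]]] ->]]].
  exists (n11 * a1 + n12 * (a2 + b1) + n13 * (a3 + c1) + n22 * b2 + n23 * (b3 + c2) + n33 * c3).
    by rewrite !formsD // (formsM _ _ _ _ _ _ _ dE) ?formsD.
  rewrite !mulrDr !(mulrA D) e11 e22 e33 e12 e13 e23; ring.
set k := ev N / ev D.
have [->//|neq] := eqVneq N (iota k * D).
have NkD0 : N - iota k * D <> 0 by move/eqP; rewrite subr_eq0 (negPf neq).
have cancelD (v w : R) : D * v = D * w -> v = w.
  move/eqP; rewrite -subr_eq0 -mulrBr => /eqP/domR[//|/eqP].
  by rewrite subr_eq0 => /eqP.
have mulNk v : v \in forms d -> exists2 w, w \in forms d & D * w = (N - iota k * D) * v.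
  move=> hv; have [w hw e] := mulN v hv; exists (w - iota k * v).
    by rewrite formsB ?formsZ.
  by rewrite mulrBr e; ring.
pose f v := nth 0 (forms d) (find (fun w => D * w == (N - iota k * D) * v) (forms d)).
have fP v : v \in forms d -> f v \in forms d /\ D * f v = (N - iota k * D) * v.
  move=> hv; have [w hw e] := mulNk v hv.
  have h : has (fun w => D * w == (N - iota k * D) * v) (forms d).
    by apply/hasP; exists w => //; apply/eqP.
  by split; [rewrite mem_nth // -has_find|apply/eqP; apply: (nth_find 0 h)].
(* The form [x2 ^+ d] is not in the image of [f]: at the point, N - k D vanishes and D does not, so
   every [f v] vanishes there, unlike x2. *)
have [|||v] := @uniq_inj_onto _ (undup (forms d)) f (undup_uniq _) _ _ (x2 ^+ d).
- move=> v w; rewrite !mem_undup => hv hw fvw.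
  have [_ ev'] := fP v hv; have [_ ew] := fP w hw.
  move: ev'; rewrite fvw ew => /eqP; rewrite -subr_eq0 -mulrBr => /eqP/domR[//|/eqP].
  by rewrite subr_eq0 => /eqP.
- by move=> v; rewrite !mem_undup => /fP[].
- have [_ h _] := forms1; rewrite mem_undup -[X in _ \in forms X]muln1.
  exact: formsX.
rewrite mem_undup => hv xE; have [_ /(congr1 ev)] := fP v hv.
rewrite -xE !(rmorphM ev) (rmorphB ev) (rmorphM ev) evK /k divfK // subrr mul0r rmorphXn => /eqP.
by rewrite mulf_eq0 (negPf evD) expf_eq0 (negPf evx2) andbF.
Qed.

End Forms.

(** * Tangents of the cubic *)

Section Identities.
Variable R : comNzRingType.
Implicit Types t r X Y : R.

Definition conic t1 t2 t3 X1 X2 X3 := t1 * X2 * X3 + t2 * X1 * X3 + t3 * X1 * X2.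

Definition cubic t1 t2 t3 r X1 X2 X3 :=
  (X1 + X2 + X3) * conic t1 t2 t3 X1 X2 X3 - r * (X1 * X2 * X3).

(* The derivative of [cubic] at X in the direction Y. *)
Definition tang t1 t2 t3 r X1 X2 X3 Y1 Y2 Y3 :=
  (Y1 + Y2 + Y3) * conic t1 t2 t3 X1 X2 X3
  + (X1 + X2 + X3) * (t1 * (Y2 * X3 + X2 * Y3) + t2 * (Y1 * X3 + X1 * Y3)
                      + t3 * (Y1 * X2 + X1 * Y2))
  - r * (Y1 * X2 * X3 + X1 * Y2 * X3 + X1 * X2 * Y3).

(* The derivative of [cubic] at (t1/X1, t2/X2, t3/X3) in the direction Y, simplified modulo [cubic]
   at X and rescaled. *)
Definition cotang t1 t2 t3 r X1 X2 X3 Y1 Y2 Y3 :=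
  t1 * t2 * t3 * (X1 + X2 + X3) ^+ 2 * (Y1 + Y2 + Y3)
  - r * (t2 * t3 * X1 ^+ 2 * Y1 + t1 * t3 * X2 ^+ 2 * Y2 + t1 * t2 * X3 ^+ 2 * Y3).

(* cotang/tang times a product of two minors of (X, Y) is regular on the square of the cubic, hence
   given by a form; these were found by linear algebra. *)
Definition quot_mixed t1 t2 t3 r X1 X2 X3 Y1 Y2 Y3 :=
  conic t1 t2 t3 X1 X2 X3 * conic t1 t2 t3 Y1 Y2 Y3
  + X3 * Y3 * (t1 * t2 * (X1 + X2 + X3) * (Y1 + Y2 + Y3)
               - r * (t2 * X1 * Y1 + t1 * X2 * Y2)).

Definition quot_square t1 t2 t3 r X1 X2 X3 Y1 Y2 Y3 :=
  (t2 * X1 + t1 * X2) * (t2 * Y1 + t1 * Y2)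
    * ((X1 + X2 + X3) * (Y1 + Y2 + Y3) + X3 * Y3)
  + X1 * X2 * Y1 * Y2 * (t3 ^+ 2 - 2%:R * r * (t1 + t2 + t3) + r ^+ 2)
  - r * (X1 * X2 * (t2 * Y1 ^+ 2 + t1 * Y2 ^+ 2) + Y1 * Y2 * (t2 * X1 ^+ 2 + t1 * X2 ^+ 2))
  + (t3 - r) * (X1 * X2 * Y3 * (t2 * Y1 + t1 * Y2) + Y1 * Y2 * X3 * (t2 * X1 + t1 * X2)).

(** After multiplication by (X1 X2 X3)^2 the equation at X eliminates r. What remains is a multiple
    of [FXY], which compares the expressions for r at X and at Y. *)
Lemma tang_quot_mixed t1 t2 t3 r X1 X2 X3 Y1 Y2 Y3 :
  cubic t1 t2 t3 r X1 X2 X3 = 0 -> cubic t1 t2 t3 r Y1 Y2 Y3 = 0 ->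
  GRing.lreg (X1 * X2 * X3) ->
  tang t1 t2 t3 r X1 X2 X3 Y1 Y2 Y3 * quot_mixed t1 t2 t3 r X1 X2 X3 Y1 Y2 Y3
  = cotang t1 t2 t3 r X1 X2 X3 Y1 Y2 Y3 * ((X2 * Y3 - X3 * Y2) * (X3 * Y1 - X1 * Y3)).
Proof.
move=> /subr0_eq FX /subr0_eq FY regX; apply: (regX); apply: (regX).
set XXX := X1 * X2 * X3 in FX *; set sX := X1 + X2 + X3 in FX *.
set sY := Y1 + Y2 + Y3 in FY *.
set cX := conic t1 t2 t3 X1 X2 X3 in FX *; set cY := conic t1 t2 t3 Y1 Y2 Y3 in FY *.
have tE : XXX * tang t1 t2 t3 r X1 X2 X3 Y1 Y2 Y3 =
    XXX * (sY * cX + sX * (t1 * (Y2 * X3 + X2 * Y3) + t2 * (Y1 * X3 + X1 * Y3)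
                      + t3 * (Y1 * X2 + X1 * Y2)))
    - sX * cX * (Y1 * X2 * X3 + X1 * Y2 * X3 + X1 * X2 * Y3).
  by rewrite FX /tang -/cX -/sX -/sY; ring.
have cE : XXX * cotang t1 t2 t3 r X1 X2 X3 Y1 Y2 Y3 =
    XXX * (t1 * t2 * t3 * sX ^+ 2 * sY)
    - sX * cX * (t2 * t3 * X1 ^+ 2 * Y1 + t1 * t3 * X2 ^+ 2 * Y2 + t1 * t2 * X3 ^+ 2 * Y3).
  by rewrite FX /cotang -/sX -/sY; ring.
have qE : XXX * quot_mixed t1 t2 t3 r X1 X2 X3 Y1 Y2 Y3 =
    XXX * (cX * cY + X3 * Y3 * (t1 * t2 * sX * sY))
    - sX * cX * (X3 * Y3 * (t2 * X1 * Y1 + t1 * X2 * Y2)).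
  by rewrite FX /quot_mixed -/cX -/cY -/sX -/sY; ring.
have FXY : sY * cY * XXX - sX * cX * (Y1 * Y2 * Y3) = 0 by rewrite FX FY; ring.
rewrite (_ : XXX * (XXX * (_ * quot_mixed _ _ _ _ _ _ _ _ _ _)) =
  (XXX * tang t1 t2 t3 r X1 X2 X3 Y1 Y2 Y3)
  * (XXX * quot_mixed t1 t2 t3 r X1 X2 X3 Y1 Y2 Y3)); last by ring.
rewrite (mulrA XXX (cotang _ _ _ _ _ _ _ _ _ _)) tE cE qE.
apply/eqP; rewrite -subr_eq0; apply/eqP.
(* The quotient of the difference of both sides by [FXY], obtained by polynomial division. *)
set c := X3 * (t1 * t2 * X1 * X2 * X3 ^+ 2 * (2%:R * X1 * X2 + X3 * (X1 + X2 + X3))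
  + X1 ^+ 2 * X2 ^+ 2 * t3 * (t3 * X1 * X2 + t2 * X1 * X3 + t1 * X2 * X3)
  - X1 * X2 * X3 * t3 * (t2 * X1 ^+ 2 * (X1 + X3) + t1 * X2 ^+ 2 * (X2 + X3))
  - X3 ^+ 2 * (t2 ^+ 2 * X1 ^+ 3 * (X1 + X3) + t1 ^+ 2 * X2 ^+ 3 * (X2 + X3))).
rewrite -[RHS](mulr0 c) -[in RHS]FXY.
rewrite /c /XXX /sX /sY /cX /cY /conic; ring.
Qed.

(** The minors M1, M2, M3 of (X, Y) satisfy X1 M1 + X2 M2 + X3 M3 = 0, hence X3 M3^2 = - X1 M1 M3 -
    X2 M2 M3; [rel] is the matching relation between the quotients. *)
Lemma tang_quot_square t1 t2 t3 r X1 X2 X3 Y1 Y2 Y3 :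
  cubic t1 t2 t3 r X1 X2 X3 = 0 -> cubic t1 t2 t3 r Y1 Y2 Y3 = 0 ->
  GRing.lreg (X1 * X2 * X3) ->
  tang t1 t2 t3 r X1 X2 X3 Y1 Y2 Y3 * quot_square t1 t2 t3 r X1 X2 X3 Y1 Y2 Y3
  = cotang t1 t2 t3 r X1 X2 X3 Y1 Y2 Y3 * ((X1 * Y2 - X2 * Y1) * (X1 * Y2 - X2 * Y1)).
Proof.
move=> FX FY regX.
have regX3 : GRing.lreg X3.
  by move=> a b ab; apply: regX; rewrite -!mulrA ab.
apply: regX3.
have e13 := @tang_quot_mixed t3 t1 t2 r X3 X1 X2 Y3 Y1 Y2.
have e23 := @tang_quot_mixed t2 t3 t1 r X2 X3 X1 Y2 Y3 Y1.
have cycF X1' X2' X3' : (cubic t3 t1 t2 r X3' X1' X2' = cubic t1 t2 t3 r X1' X2' X3') *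
    (cubic t2 t3 t1 r X2' X3' X1' = cubic t1 t2 t3 r X1' X2' X3').
  by split; rewrite /cubic /conic; ring.
have cycT : (tang t3 t1 t2 r X3 X1 X2 Y3 Y1 Y2 = tang t1 t2 t3 r X1 X2 X3 Y1 Y2 Y3) *
    (tang t2 t3 t1 r X2 X3 X1 Y2 Y3 Y1 = tang t1 t2 t3 r X1 X2 X3 Y1 Y2 Y3).
  by split; rewrite /tang /conic; ring.
have cycC : (cotang t3 t1 t2 r X3 X1 X2 Y3 Y1 Y2 = cotang t1 t2 t3 r X1 X2 X3 Y1 Y2 Y3) *
    (cotang t2 t3 t1 r X2 X3 X1 Y2 Y3 Y1 = cotang t1 t2 t3 r X1 X2 X3 Y1 Y2 Y3).
  by split; rewrite /cotang; ring.
rewrite !cycF !cycT !cycC in e13 e23.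
have {e13} := e13 FX FY _; rewrite (_ : X3 * X1 * X2 = X1 * X2 * X3); last by ring.
move=> /(_ regX) e13.
have {e23} := e23 FX FY _; rewrite (_ : X2 * X3 * X1 = X1 * X2 * X3); last by ring.
move=> /(_ regX) e23.
have rel : X3 * quot_square t1 t2 t3 r X1 X2 X3 Y1 Y2 Y3 =
    - X1 * quot_mixed t3 t1 t2 r X3 X1 X2 Y3 Y1 Y2
    - X2 * quot_mixed t2 t3 t1 r X2 X3 X1 Y2 Y3 Y1.
  apply/eqP; rewrite -subr_eq0; apply/eqP.
  rewrite -[RHS](mulr0 (t2 * Y1 ^+ 2 + (t1 + t2 + t3 - r) * Y1 * Y2 + 2%:R * t2 * Y1 * Y3
    + t1 * Y2 ^+ 2 + 2%:R * t1 * Y2 * Y3)) -FX.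
  by rewrite /quot_square /quot_mixed /cubic /conic; ring.
rewrite mulrCA rel mulrDr !mulNr !mulrN !(mulrCA (tang _ _ _ _ _ _ _ _ _ _)) e13 e23; ring.
Qed.
End Identities.

Section Morphism.
Variables (R S : comNzRingType) (f : {rmorphism R -> S}).

Lemma rmorph_tang (t1 t2 t3 r X1 X2 X3 Y1 Y2 Y3 : R) :
  f (tang R t1 t2 t3 r X1 X2 X3 Y1 Y2 Y3) =
  tang S (f t1) (f t2) (f t3) (f r) (f X1) (f X2) (f X3) (f Y1) (f Y2) (f Y3).
Proof. by rewrite /tang /conic !(rmorphB, rmorphD, rmorphM). Qed.

Lemma rmorph_cotang (t1 t2 t3 r X1 X2 X3 Y1 Y2 Y3 : R) :
  f (cotang R t1 t2 t3 r X1 X2 X3 Y1 Y2 Y3) =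
  cotang S (f t1) (f t2) (f t3) (f r) (f X1) (f X2) (f X3) (f Y1) (f Y2) (f Y3).
Proof. by rewrite /cotang !(rmorphB, rmorphD, rmorphM, rmorphXn). Qed.
End Morphism.

Lemma cubicC (S : comNzRingType) (a1 a2 a3 b X1 X2 X3 : S) :
  cubic S a2 a3 a1 b X2 X3 X1 = cubic S a1 a2 a3 b X1 X2 X3.
Proof. by rewrite /cubic /conic; ring. Qed.

(** * The tangent quotients as forms *)

Section FormsQuotient.
Variables (L : finFieldType) (R : comNzRingType) (iota : {rmorphism L -> R}).
Variables (x1 x2 x3 : R) (t1 t2 t3 r : L).

Local Notation T1 := (iota t1).
Local Notation T2 := (iota t2).
Local Notation T3 := (iota t3).
Local Notation r' := (iota r).
Local Notation Fm d := (forms L R iota x1 x2 x3 d).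

Lemma forms_conic d X1 X2 X3 : X1 \in Fm d -> X2 \in Fm d -> X3 \in Fm d ->
  conic R T1 T2 T3 X1 X2 X3 \in Fm (2 * d).
Proof.
by move=> h1 h2 h3; rewrite /conic -!mulrA !formsD ?formsZ ?(formsM _ _ _ _ _ _ d d) //; lia.
Qed.

Lemma forms_quot_mixed d e X1 X2 X3 Y1 Y2 Y3 :
  X1 \in Fm d -> X2 \in Fm d -> X3 \in Fm d -> Y1 \in Fm e -> Y2 \in Fm e -> Y3 \in Fm e ->
  quot_mixed R T1 T2 T3 r' X1 X2 X3 Y1 Y2 Y3 \in Fm (2 * e + 2 * d).
Proof.
move=> h1 h2 h3 k1 k2 k3; have XY X Y : X \in Fm d -> Y \in Fm e -> X * Y \in Fm (d + e).
  by move=> hX hY; apply: formsM hX hY _.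
rewrite /quot_mixed formsD //.
  by apply: formsM; [apply: forms_conic h1 h2 h3|apply: forms_conic k1 k2 k3|lia].
have eE : (2 * e + 2 * d = d + e + (d + e))%N by lia.
apply: formsM (XY _ _ h3 k3) _ eE; rewrite formsB //.
  by rewrite -mulrA -rmorphM formsZ // XY ?formsD.
by rewrite formsZ // formsD // -mulrA formsZ // XY.
Qed.

Lemma forms_quot_square d e X1 X2 X3 Y1 Y2 Y3 :
  X1 \in Fm d -> X2 \in Fm d -> X3 \in Fm d -> Y1 \in Fm e -> Y2 \in Fm e -> Y3 \in Fm e ->
  quot_square R T1 T2 T3 r' X1 X2 X3 Y1 Y2 Y3 \in Fm (2 * e + 2 * d).
Proof.
move=> h1 h2 h3 k1 k2 k3.
have eE : (2 * e + 2 * d = d + e + (d + e))%N by lia.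
have XY X Y : X \in Fm d -> Y \in Fm e -> X * Y \in Fm (d + e).
  by move=> hX hY; apply: formsM hX hY _.
have XYXY X Y X' Y' : X \in Fm d -> Y \in Fm e -> X' \in Fm d -> Y' \in Fm e ->
    X * Y * (X' * Y') \in Fm (2 * e + 2 * d).
  by move=> hX hY hX' hY'; apply: formsM (XY _ _ hX hY) (XY _ _ hX' hY') eE.
have lX : T2 * X1 + T1 * X2 \in Fm d by rewrite formsD ?formsZ.
have lY : T2 * Y1 + T1 * Y2 \in Fm e by rewrite formsD ?formsZ.
(* Regrouping into products of two factors X Y exhibits the bidegree (2, 2). *)
have -> : quot_square R T1 T2 T3 r' X1 X2 X3 Y1 Y2 Y3 =
  (T2 * X1 + T1 * X2) * (T2 * Y1 + T1 * Y2) * ((X1 + X2 + X3) * (Y1 + Y2 + Y3))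
  + (T2 * X1 + T1 * X2) * (T2 * Y1 + T1 * Y2) * (X3 * Y3)
  + iota (t3 ^+ 2 - 2%:R * r * (t1 + t2 + t3) + r ^+ 2) * (X1 * Y1 * (X2 * Y2))
  - r' * (T2 * (X1 * Y1 * (X2 * Y1)) + T1 * (X1 * Y2 * (X2 * Y2))
          + (T2 * (X1 * Y1 * (X1 * Y2)) + T1 * (X2 * Y1 * (X2 * Y2))))
  + iota (t3 - r) * (X1 * Y3 * (X2 * (T2 * Y1 + T1 * Y2))
          + X3 * Y1 * ((T2 * X1 + T1 * X2) * Y2)).
  rewrite !(rmorphD, rmorphB, rmorphN, rmorphM, rmorphXn, rmorph_nat) /quot_square; ring.
by do ?[apply: formsD|apply: formsB|apply: formsN|apply: formsZ|apply: XYXY|assumption].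
Qed.

End FormsQuotient.

(** * The tangent quotient at a point and its Frobenius image *)

Section Quotient.
Variables (L : finFieldType) (R : comNzRingType) (iota : {rmorphism L -> R}).
Variables (q : nat) (x1 x2 x3 : R).
Hypothesis q_gt1 : (1 < q)%N.
Hypothesis cardL : #|L| = (q ^ 3)%N.
Hypothesis pcharq : [pchar R].-nat q.
Hypothesis domR : forall v w : R, v * w = 0 -> v = 0 \/ w = 0.
Variables t1 t2 t3 r : L.
Hypotheses (t12 : t1 ^+ q = t2) (t23 : t2 ^+ q = t3) (t31 : t3 ^+ q = t1) (rq : r ^+ q = r).

Local Notation T1 := (iota t1).
Local Notation T2 := (iota t2).
Local Notation T3 := (iota t3).
Local Notation r' := (iota r).
Local Notation y1 := (x3 ^+ q).
Local Notation y2 := (x1 ^+ q).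
Local Notation y3 := (x2 ^+ q).
Local Notation Fm d := (forms L R iota x1 x2 x3 d).

Lemma cubic_Frobenius : cubic R T1 T2 T3 r' x1 x2 x3 = 0 ->
  cubic R T1 T2 T3 r' y1 y2 y3 = 0.
Proof.
move=> F0; rewrite -cubicC.
suff <- : cubic R T1 T2 T3 r' x1 x2 x3 ^+ q = cubic R T2 T3 T1 r' y2 y3 y1.
  by rewrite F0 expr0n; case: (q) q_gt1.
rewrite /cubic /conic !(exprDn_pchar _ _ pcharq, exprNn_pchar _ pcharq, exprMn).
by rewrite -!rmorphXn t12 t23 t31 rq.
Qed.

Hypothesis Fx0 : cubic R T1 T2 T3 r' x1 x2 x3 = 0.
Hypothesis Fc_neq0 : forall w : L, w != 0 ->
  cubic L t1 t2 t3 r w (w ^+ q) (w ^+ (q ^ 2)) != 0.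
Hypotheses (x1n0 : x1 <> 0) (x2n0 : x2 <> 0) (x3n0 : x3 <> 0).

Local Notation tg := (tang R T1 T2 T3 r' x1 x2 x3 y1 y2 y3).
Local Notation ct := (cotang R T1 T2 T3 r' x1 x2 x3 y1 y2 y3).

Lemma cotang_proportional (ev : {rmorphism R -> L}) :
  cancel iota ev -> ev tg != 0 -> ev x2 != 0 -> ct = iota (ev ct / ev tg) * tg.
Proof.
move=> evK evt evx2.
have regX : GRing.lreg (x1 * x2 * x3).
  move=> v w /eqP; rewrite -subr_eq0 -mulrBr => /eqP.
  case/domR=> [/domR[/domR[]|]//|/eqP]; by rewrite subr_eq0 => /eqP.
have regX' : GRing.lreg (x2 * x3 * x1) by rewrite (_ : _ * x1 = x1 * x2 * x3) //; ring.
have regX'' : GRing.lreg (x3 * x1 * x2) by rewrite (_ : _ * x2 = x1 * x2 * x3) //; ring.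
have Fy0 := cubic_Frobenius Fx0.
pose F : seq (L * (nat * nat * nat)) := [:: (t1 + t2 + t3 - r, (1, 1, 1)%N);
  (t3, (2, 1, 0)%N); (t2, (2, 0, 1)%N); (t3, (1, 2, 0)%N); (t1, (0, 2, 1)%N);
  (t2, (1, 0, 2)%N); (t1, (0, 1, 2)%N)].
have h1 : [/\ x1 \in Fm 1, x2 \in Fm 1 & x3 \in Fm 1] by apply: forms1.
have [hx1 hx2 hx3] := h1.
have hy x : x \in Fm 1 -> x ^+ q \in Fm q.
  by move=> hx; rewrite -[X in _ \in forms _ _ _ _ _ _ X]muln1 formsX.
have cycT : (tang R T2 T3 T1 r' x2 x3 x1 y2 y3 y1 = tg) *
    (tang R T3 T1 T2 r' x3 x1 x2 y3 y1 y2 = tg).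
  by split; rewrite /tang /conic; ring.
have cycC : (cotang R T2 T3 T1 r' x2 x3 x1 y2 y3 y1 = ct) *
    (cotang R T3 T1 T2 r' x3 x1 x2 y3 y1 y2 = ct).
  by split; rewrite /cotang; ring.
have Fx1 : cubic R T2 T3 T1 r' x2 x3 x1 = 0 by rewrite cubicC.
have Fy1 : cubic R T2 T3 T1 r' y2 y3 y1 = 0 by rewrite cubicC.
have Fx2 : cubic R T3 T1 T2 r' x3 x1 x2 = 0 by rewrite cubicC.
have Fy2 : cubic R T3 T1 T2 r' y3 y1 y2 = 0 by rewrite cubicC.
(* The six products of two minors are covered by the square and mixed identities and their cyclic
   permutations. *)
apply: (@regular_const L R iota x1 x2 x3 q q_gt1 cardL F _ _ _ domR tg ct
  (quot_square R T2 T3 T1 r' x2 x3 x1 y2 y3 y1)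
  (quot_square R T3 T1 T2 r' x3 x1 x2 y3 y1 y2)
  (quot_square R T1 T2 T3 r' x1 x2 x3 y1 y2 y3)
  (quot_mixed R T1 T2 T3 r' x1 x2 x3 y1 y2 y3)
  (quot_mixed R T3 T1 T2 r' x3 x1 x2 y3 y1 y2)
  (quot_mixed R T2 T3 T1 r' x2 x3 x1 y2 y3 y1) ev) => //.
- by move=> m; rewrite !inE => /or4P[/eqP->|/eqP->|/eqP->|/or4P[]/eqP->].
- rewrite -[RHS]Fx0 /F !big_cons big_nil /mon /= rmorphB !rmorphD /cubic /conic; ring.
- move=> w /Fc_neq0; apply: contra_neq => h; rewrite -[RHS]h.
  rewrite /F !big_cons big_nil /= !expr_wt /cubic /conic; ring.
- rewrite /= (_ : 2 * q + 2 = 2 * q + 2 * 1)%N //.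
  by rewrite !(forms_quot_square, forms_quot_mixed) ?hy.
- rewrite -cycT.1 -cycC.1 (tang_quot_square _ _ _ _ _ _ _ _ _ _ _ Fx1 Fy1 regX').
  by rewrite /minor1 exprS; ring.
- rewrite -cycT.2 -cycC.2 (tang_quot_square _ _ _ _ _ _ _ _ _ _ _ Fx2 Fy2 regX'').
  by rewrite /minor2 exprS; ring.
- rewrite (tang_quot_square _ _ _ _ _ _ _ _ _ _ _ Fx0 Fy0 regX).
  by rewrite /minor3 exprS; ring.
- rewrite (tang_quot_mixed _ _ _ _ _ _ _ _ _ _ _ Fx0 Fy0 regX).
  by rewrite /minor1 /minor2 !exprS; ring.
- rewrite -cycT.2 -cycC.2 (tang_quot_mixed _ _ _ _ _ _ _ _ _ _ _ Fx2 Fy2 regX'').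
  by rewrite /minor1 /minor3 !exprS; ring.
- rewrite -cycT.1 -cycC.1 (tang_quot_mixed _ _ _ _ _ _ _ _ _ _ _ Fx1 Fy1 regX').
  by rewrite /minor2 /minor3 !exprS; ring.
Qed.
End Quotient.

(** * Cubics without points *)

Section CurvePoint.
Variables (L : finFieldType) (q p m : nat).
Hypotheses (p_prime : prime p) (p_odd : odd p) (m_gt0 : (0 < m)%N) (qE : q = (p ^ m)%N).
Hypothesis cardL : #|L| = (q ^ 3)%N.

Lemma pcharL : p \in [pchar L].
Proof. by apply: (@card_finPcharP _ _ (m * 3)) => //; rewrite cardL qE expnM. Qed.

Lemma pchar_nat (S : comNzRingType) (f : {rmorphism L -> S}) : [pchar S].-nat q.
Proof.
rewrite qE pnatX; apply/orP; left.
by rewrite pnatE // (rmorph_pchar f) ?pcharL.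
Qed.

Lemma two_neq0 : 2%:R != 0 :> L.
Proof.
rewrite -(dvdn_pcharf pcharL) dvdn_prime2 //.
by apply: contraTneq p_odd => ->.
Qed.

Lemma q_gt1 : (1 < q)%N.
Proof. by rewrite qE -{1}(exp1n m) ltn_exp2r ?prime_gt1. Qed.

Lemma q_odd : odd q.
Proof. by rewrite qE oddX p_odd orbT. Qed.

Section GenericPoint.
Variables t1 t2 t3 r : L.
Hypotheses (t1n0 : t1 != 0) (t2n0 : t2 != 0) (t3n0 : t3 != 0) (rn0 : r != 0).
Hypotheses (n12 : t1 != t2) (n13 : t1 != t3) (n23 : t2 != t3).
Variable lam : L.
Hypothesis lamE : lam = t1 + t2 + t3 - r.

Definition qlin : {poly L} := t2%:P * 'X + t1%:P.
Definition qmid : {poly L} := t2%:P * 'X^2 + lam%:P * 'X + t1%:P.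
(* The discriminant of [cubic t1 t2 t3 r 'X 1 Z] as a quadratic polynomial in Z. *)
Definition disc : {poly L} := qmid ^+ 2 - 4%:R * t3%:P * 'X * ('X + 1) * qlin.

(** This makes the ring of the generic point a domain. Up to sign a square root has leading
    coefficient t2 and constant term t1 or - t1; the former forces t3 r = 0, the latter (t3 - t1)(t3
    - t2) = 0. *)
Lemma disc_nonsquare s : disc != s ^+ 2.
Proof.
have n2 := two_neq0; have n4 : 4%:R != 0 :> L by rewrite (natrM _ 2 2) mulf_neq0.
have discE : disc = Poly [:: t1 ^+ 2; 2%:R * t1 * (lam - 2%:R * t3);
   lam ^+ 2 + 2%:R * t1 * t2 - 4%:R * t3 * (t1 + t2); 2%:R * t2 * (lam - 2%:R * t3); t2 ^+ 2].
  rewrite /disc /qmid /qlin /= !cons_poly_def.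
  rewrite !(polyCD, polyCB, polyCN, polyCM, polyC_exp, polyC_natr, mul0r, add0r).
  by ring.
apply/eqP => ds.
have size_s : (size s <= 3)%N.
  have : ((size s).-1 * 2 <= 4)%N.
    by rewrite -size_exp -ds discE -subn1 leq_subLR; apply: size_Poly.
  by case: (size s) => [|[|[|[|n]]]].
have sE : s = Poly [:: s`_0; s`_1; s`_2].
  by apply/polyP => -[|[|[|i]]]; rewrite coef_Poly //= nth_nil nth_default // (leq_trans size_s).
have s2E : s ^+ 2 = Poly [:: s`_0 ^+ 2; 2%:R * s`_0 * s`_1; s`_1 ^+ 2 + 2%:R * s`_0 * s`_2;
    2%:R * s`_2 * s`_1; s`_2 ^+ 2].
  rewrite {1}sE /= !cons_poly_def.
  rewrite !(polyCD, polyCB, polyCN, polyCM, polyC_exp, polyC_natr, mul0r, add0r).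
  by ring.
have co i := congr1 (fun h : {poly L} => h`_i) (etrans (etrans (esym discE) ds) s2E).
move: {co} (co 0%N) (co 1%N) (co 2%N) (co 3%N) (co 4%N); rewrite !coef_Poly /=.
move: {ds sE s2E size_s} (s`_0) (s`_1) (s`_2) => a b c e0 e1 e2 e3 e4.
wlog ct : a b c e0 e1 e2 e3 e4 / t2 = c => [hw|].
  move/eqP: (e4); rewrite eqf_sqr => /orP[/eqP ct|/eqP ct]; first exact: (hw a b c).
  by apply: (hw (- a) (- b) (- c)); rewrite ?sqrrN ?mulrNN // !(mulrN, mulNr) ?opprK.
subst c; have be : lam - 2%:R * t3 = b.
  by apply: (mulfI (mulf_neq0 n2 t2n0)); rewrite e3.
move/eqP: e0; rewrite eqf_sqr => /orP[/eqP ta|/eqP ta].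
  have : 4%:R * t3 * r = 0.
    have -> : 4%:R * t3 * r = (lam - 2%:R * t3) ^+ 2 + 2%:R * t1 * t2
      - (lam ^+ 2 + 2%:R * t1 * t2 - 4%:R * t3 * (t1 + t2)) by rewrite lamE; ring.
    by rewrite e2 be ta; ring.
  by apply/eqP; rewrite !mulf_neq0.
have b0 : b = 0.
  have : 4%:R * t1 * b = 0.
    have -> : 4%:R * t1 * b = 2%:R * t1 * (lam - 2%:R * t3) - 2%:R * (- t1) * b.
      by rewrite be; ring.
    by rewrite e1 ta; ring.
  by move/eqP; rewrite !mulf_eq0 (negPf n4) (negPf t1n0) /= => /eqP.
have : 4%:R * (t3 - t1) * (t3 - t2) = 0.
  have -> : 4%:R * (t3 - t1) * (t3 - t2) = (lam ^+ 2 + 2%:R * t1 * t2 - 4%:R * t3 * (t1 + t2))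
    - (2%:R * (- t1) * t2) - (lam - 2%:R * t3) * (lam + 2%:R * t3) by ring.
  by rewrite e2 be b0 ta; ring.
by apply/eqP; rewrite !mulf_neq0 // subr_eq0 eq_sym.
Qed.

Local Notation R := (quad {poly L} disc).
Local Notation C := (quadC {poly L} disc).
(* The generic point of the cubic, scaled by 2 * qlin to clear denominators. *)
Definition iotaQ : {rmorphism L -> R} := (C \o polyC : {rmorphism L -> R}).
Definition gen2 : R := C (2%:R * qlin).
Definition gen1 : R := C 'X * gen2.
Definition gen3 : R := quad_sqrt {poly L} disc - C qmid.

(** At ('X, 1, Z) the cubic is qlin Z^2 + qmid Z + t3 X (X + 1), and gen3 / gen2 is its root by the
    quadratic formula. *)
Lemma generic_cubic : cubic R (iotaQ t1) (iotaQ t2) (iotaQ t3) (iotaQ r) gen1 gen2 gen3 = 0.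
Proof.
have s2 := quad_sqrtK {poly L} disc.
have gE : gen2 = 2%:R * C qlin by rewrite /gen2 rmorphM rmorph_nat.
rewrite /gen1 /gen3 gE.
have CE : C disc = C qmid ^+ 2 - 4%:R * iotaQ t3 * C 'X * (C 'X + 1) * C qlin.
  by rewrite {2}/disc rmorphB rmorphXn !rmorphM rmorph_nat (rmorphD C 'X) rmorph1.
have mE : C qmid = iotaQ t2 * C 'X ^+ 2 + iotaQ lam * C 'X + iotaQ t1.
  by rewrite /qmid !rmorphD (rmorphM C _ 'X^2) rmorphXn rmorphM.
have lE : C qlin = iotaQ t2 * C 'X + iotaQ t1 by rewrite /qlin rmorphD rmorphM.
have laE : iotaQ lam = iotaQ t1 + iotaQ t2 + iotaQ t3 - iotaQ r.
  by rewrite lamE rmorphB !rmorphD.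
move: s2; rewrite CE; move: mE lE laE; move: (C qmid) (C qlin) (C 'X) (iotaQ lam) (quad_sqrt _ _).
move: (iotaQ t1) (iotaQ t2) (iotaQ t3) (iotaQ r) => T1 T2 T3 r' b l x la s bE lE laE sE.
apply/eqP; rewrite -subr_eq0; apply/eqP.
rewrite -[RHS](mulr0 (2%:R * l * l)) -[in RHS](subrr (s ^+ 2)) {2}sE lE bE laE.
rewrite /cubic /conic; ring.
Qed.

Hypotheses (t12 : t1 ^+ q = t2) (t23 : t2 ^+ q = t3) (t31 : t3 ^+ q = t1) (rq : r ^+ q = r).

Lemma no_point_contra :
  ~ (forall w : L, w != 0 -> cubic L t1 t2 t3 r w (w ^+ q) (w ^+ (q ^ 2)) != 0).
Proof.
move=> Fc_neq0.
have n2 := two_neq0; have qn0 : q <> 0%N by move=> q0; have := q_gt1; rewrite q0.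
(* At 0 and at -1, [disc] is the square of the value of [qmid]. Taking this value as the root makes
   [gen3] vanish, which gives the points (0, 1, 0) and (-1, 1, 0). *)
have hv : t1 ^+ 2 = horner_eval (0 : L) disc.
  by rewrite /horner_eval /disc /qmid /qlin !(hornerE, horner_exp) /=; ring.
have hv' : (t2 - lam + t1) ^+ 2 = horner_eval (-1 : L) disc.
  by rewrite /horner_eval /disc /qmid /qlin !(hornerE, horner_exp) /=; ring.
pose ev : {rmorphism R -> L} := quad_eval _ _ _ _ _ hv.
pose ev' : {rmorphism R -> L} := quad_eval _ _ _ _ _ hv'.
have evC h : ev (C h) = h.[0] by apply: quad_evalC.
have evC' h : ev' (C h) = h.[-1] by apply: quad_evalC.
have evS : ev (quad_sqrt _ _) = t1 by apply: quad_eval_sqrt.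
have evS' : ev' (quad_sqrt _ _) = t2 - lam + t1 by apply: quad_eval_sqrt.
have evK : cancel iotaQ ev by move=> c; rewrite evC hornerC.
have evK' : cancel iotaQ ev' by move=> c; rewrite evC' hornerC.
have ev1 : ev gen1 = 0 by rewrite /gen1 rmorphM !evC hornerX mul0r.
have ev2 : ev gen2 = 2%:R * t1.
  by rewrite /gen2 evC /qlin !hornerE; ring.
have ev3 : ev gen3 = 0.
  by rewrite /gen3 rmorphB evC evS /qmid !(hornerE, horner_exp) /=; ring.
have ev2' : ev' gen2 = 2%:R * (t1 - t2).
  by rewrite /gen2 evC' /qlin !hornerE; ring.
have ev1' : ev' gen1 = - ev' gen2 by rewrite /gen1 rmorphM evC' hornerX mulN1r.
have ev3' : ev' gen3 = 0.
  by rewrite /gen3 rmorphB evC' evS' /qmid !(hornerE, horner_exp) /=; ring.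
have gen_neq0 (x : R) : ev x != 0 -> x <> 0 by move=> h x0; rewrite x0 rmorph0 eqxx in h.
have x2n0 : ev gen2 != 0 by rewrite ev2 mulf_neq0.
have d0 : ev' gen2 != 0 by rewrite ev2' mulf_neq0 // subr_eq0.
have gen1n0 : gen1 <> 0.
  by move=> h; move: (congr1 ev' h); rewrite ev1' rmorph0 => /eqP; rewrite oppr_eq0 (negPf d0).
have gen3n0 : gen3 <> 0 by move=> h; move/eqP: (congr1 snd h); rewrite /= subr0 oner_eq0.
have T := @cotang_proportional L R iotaQ q gen1 gen2 gen3 q_gt1 cardL (pchar_nat _ iotaQ)
  (@quad_domain L disc disc_nonsquare) t1 t2 t3 r t12 t23 t31 rq generic_cubic Fc_neq0
  gen1n0 (gen_neq0 _ x2n0) gen3n0 ev evK.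
set c := ev gen2 in x2n0; set c' := ev' gen2 in d0.
set tg := tang _ _ _ _ _ _ _ _ _ _ _ in T; set ct := cotang _ _ _ _ _ _ _ _ _ _ _ in T.
have oq : odd q := q_odd.
have z0 : (0 : L) ^+ q = 0 by rewrite expr0n; case: (q) qn0.
have cN : (- c') ^+ q = - c' ^+ q by rewrite exprNn -signr_odd oq mulN1r.
have etg : ev tg = t1 * c ^+ 2 * c ^+ q.
  rewrite /tg rmorph_tang !(rmorphXn ev) !evK ev1 ev3 -/c z0.
  by move: (c ^+ q) => cq; rewrite /tang /conic; ring.
have ect : ev ct = t1 * t2 * t3 * c ^+ 2 * c ^+ q.
  rewrite /ct rmorph_cotang !(rmorphXn ev) !evK ev1 ev3 -/c z0.
  by move: (c ^+ q) => cq; rewrite /cotang; ring.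
have etg' : ev' tg = r * c' ^+ 2 * c' ^+ q.
  rewrite /tg rmorph_tang !(rmorphXn ev') !evK' ev1' ev3' -/c' z0 cN.
  by move: (c' ^+ q) => cq; rewrite /tang /conic; ring.
have ect' : ev' ct = r * (t1 * t3) * c' ^+ 2 * c' ^+ q.
  rewrite /ct rmorph_cotang !(rmorphXn ev') !evK' ev1' ev3' -/c' z0 cN.
  by move: (c' ^+ q) => cq; rewrite /cotang; ring.
have tgn0 : ev tg != 0 by rewrite etg !mulf_neq0 ?expf_neq0.
have := congr1 ev' (T tgn0 x2n0); rewrite (rmorphM ev') evK' etg ect etg' ect' => E.
have {E} : r * c' ^+ 2 * c' ^+ q * (t3 * (t1 - t2)) = 0.
  have -> : r * c' ^+ 2 * c' ^+ q * (t3 * (t1 - t2)) = r * (t1 * t3) * c' ^+ 2 * c' ^+ q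
    - t2 * t3 * (r * c' ^+ 2 * c' ^+ q) by ring.
  by rewrite E; clearbody c; field; rewrite t1n0 x2n0 expf_neq0.
by apply/eqP; rewrite !mulf_neq0 ?expf_neq0 // subr_eq0.
Qed.
End GenericPoint.
End CurvePoint.

(** * The equation Tr(w) Tr(y/w) = r *)

Section TraceCurve.
Variables (L : finFieldType) (q p m : nat).
Hypotheses (p_prime : prime p) (p_odd : odd p) (m_gt0 : (0 < m)%N) (qE : q = (p ^ m)%N).
Hypothesis cardL : #|L| = (q ^ 3)%N.
Local Notation Tr := (@Tr3 L q).

Let q1 : (1 < q)%N := q_gt1 _ _ _ p_prime m_gt0 qE.
Let pcharq : [pchar L].-nat q := pchar_nat _ _ _ _ p_prime qE cardL _ (idfun : {rmorphism L -> L}).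

Lemma frobB (x y : L) : (x - y) ^+ q = x ^+ q - y ^+ q.
Proof. by rewrite exprDn_pchar // exprNn_pchar. Qed.

Lemma frob3 (v : L) : ((v ^+ q) ^+ q) ^+ q = v.
Proof.
by rewrite -!exprM (_ : (q * (q * q) = q ^ 3)%N) ?exprq3 // !expnS expn0 muln1.
Qed.

Lemma exists_nonfixed : exists v : L, v ^+ q != v.
Proof.
apply/existsP; apply: contraT; rewrite negb_exists => /forallP h.
have h' (v : L) : v ^+ q = v by apply/eqP; move: (h v); rewrite negbK.
pose P : {poly L} := 'X^q - 'X.
have sP : size P = q.+1 by rewrite size_polyDl ?size_polyXn // size_polyN size_polyX.
have : (size (enum L) < size P)%N.
  apply: max_poly_roots; rewrite ?enum_uniq //; first by rewrite -size_poly_gt0 sP.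
  by apply/allP => v _; rewrite /root !(hornerE, horner_exp) h' subrr.
by rewrite -cardE cardL sP; have := q1; nia.
Qed.

Lemma Tr0_exists : exists2 w : L, w != 0 & Tr w = 0.
Proof.
have [v hv] := exists_nonfixed; exists (v ^+ q - v); first by rewrite subr_eq0.
by rewrite /Tr3 (exprM _ q q) !frobB frob3; ring.
Qed.

(** The polynomial X^(q^3) - X already splits over L, so it has no further roots in E. *)
Lemma frob_fixed_in (E : fieldExtType L) (z : E) : z ^+ (q ^ 3) = z -> exists x : L, z = x%:A.
Proof.
move=> zq; have := congr1 (fun P => (map_poly (in_alg E) P).[z]) (finField_genPoly L).
rewrite rmorphB /= map_polyXn map_polyX !(hornerE, horner_exp) cardL zq subrr.
rewrite rmorph_prod horner_prod => /esym/eqP/prodf_eq0[x _].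
rewrite rmorphB /= map_polyX map_polyC !hornerE subr_eq0 => /eqP ->.
by exists x.
Qed.

(* In a splitting field, a Frobenius orbit of fewer than three roots would yield a fixed root. *)
Lemma cubic_conj_roots (a b c : L) : a ^+ q = a -> b ^+ q = b -> c ^+ q = c ->
  (forall x, x ^+ q = x -> x ^+ 3 - a * x ^+ 2 + b * x - c != 0) ->
  exists x : L, [/\ x + x ^+ q + x ^+ (q ^ 2) = a,
    x * x ^+ q + x ^+ q * x ^+ (q ^ 2) + x * x ^+ (q ^ 2) = b
    & x * x ^+ q * x ^+ (q ^ 2) = c].
Proof.
move=> aq bq cq noroot.
pose P : {poly L} := 'X^3 - a *: 'X^2 + b *: 'X - c%:P.
have Pn0 : P != 0.
  apply/eqP => P0; have := noroot 0; rewrite expr0n; case: (q) q1 => // n _ /(_ erefl).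
  have /(congr1 (fun Q : {poly L} => Q.[0])) := P0.
  by rewrite /P !(hornerE, horner_exp) /= => ->; rewrite eqxx.
have [E [rs Prs _]] := FinSplittingFieldFor Pn0.
pose f : {rmorphism L -> E} := in_alg E.
have pE : [pchar E].-nat q := pchar_nat _ _ _ _ p_prime qE cardL _ f.
have eB (x y : E) : (x - y) ^+ q = x ^+ q - y ^+ q by rewrite exprDn_pchar // exprNn_pchar.
have eD (x y : E) : (x + y) ^+ q = x ^+ q + y ^+ q by rewrite exprDn_pchar.
have q0 : (0 < q)%N by apply: leq_trans q1.
pose g (z : E) := z ^+ 3 - f a * z ^+ 2 + f b * z - f c.
have gP z : (map_poly f P).[z] = g z.
  rewrite /P rmorphB rmorphD rmorphB /= !map_polyZ map_polyC !map_polyXn map_polyX.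
  by rewrite /g !(hornerE, horner_exp).
have [v gv] : exists v, g v = 0.
  have sP : size P = 4%N.
    rewrite /P -addrA -addrA size_polyDl ?size_polyXn // ltnS.
    apply: leq_trans (size_polyD _ _) _; rewrite geq_max size_polyN.
    rewrite (leq_trans (size_scale_leq _ _)) ?size_polyXn //=.
    apply: leq_trans (size_polyD _ _) _; rewrite geq_max size_polyN size_polyC.
    by rewrite (leq_trans (size_scale_leq _ _)) ?size_polyX //=; case: (c != 0).
  case: rs Prs => [|v rs] Prs.
    by have := eqp_size Prs; rewrite big_nil size_poly1 size_map_poly sP.
  exists v; apply/eqP; rewrite -gP -/(root _ _) (eqp_root Prs) big_cons.
  by rewrite rootM root_XsubC eqxx.
have gq z : g z = 0 -> g (z ^+ q) = 0.
  move=> /(congr1 (fun t => t ^+ q)); rewrite expr0n gtn_eqF //.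
  rewrite /g !(eB, eD) !exprMn -!(rmorphXn f) aq bq cq.
  by move=> h; rewrite -[RHS]h; ring.
have gsub x y : g x = 0 -> g y = 0 -> x != y ->
    x ^+ 2 + x * y + y ^+ 2 - f a * (x + y) + f b = 0.
  move=> gx gy xy; have : (x - y) * (x ^+ 2 + x * y + y ^+ 2 - f a * (x + y) + f b) = g x - g y.
    by rewrite /g; ring.
  by rewrite gx gy subrr => /eqP; rewrite mulf_eq0 subr_eq0 (negPf xy) => /eqP.
have nofix z : g z = 0 -> z ^+ q != z.
  move=> gz; apply/eqP => zq.
  have [x zx] : exists x : L, z = f x.
    by apply: frob_fixed_in; rewrite !expnS expn0 muln1 !exprM !zq.
  have xq : x ^+ q = x by apply: (fmorph_inj f); rewrite rmorphXn -zx.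
  move/eqP: (noroot x xq); apply; apply: (fmorph_inj f).
  by rewrite rmorph0 -gz zx /g rmorphB rmorphD rmorphB (rmorphM f a) (rmorphM f b) !(rmorphXn f).
have inj_q (x y : E) : x ^+ q = y ^+ q -> x = y.
  move/eqP; rewrite -subr_eq0 -eB expf_eq0 q0 subr_eq0 /= => /eqP //.
pose w := v ^+ q; pose z := w ^+ q.
have gw : g w = 0 by apply: gq.
have gz : g z = 0 by apply: gq.
have vw : v != w by rewrite eq_sym; apply: nofix.
have wz : w != z by rewrite eq_sym; apply: nofix.
have vieta t : g t = 0 -> t != v -> t != w -> v + w + t = f a.
  move=> gt tv tw.
  have h1 := gsub _ _ gv gw vw; have h2 := gsub _ _ gt gw tw.
  apply/eqP; rewrite -subr_eq0; apply/eqP.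
  have : (v - t) * (v + w + t - f a) = 0.
    by rewrite -[RHS](subrr 0) -{1}h1 -h2; ring.
  by move/eqP; rewrite mulf_eq0 subr_eq0 eq_sym (negPf tv) => /eqP.
(* Otherwise Frobenius exchanges v and w, so the third root a - v - w is fixed, contrary to
   [nofix]. *)
have vz : v != z.
  apply/eqP => vz; pose t := f a - v - w.
  have gt : g t = 0.
    have h1 := gsub _ _ gv gw vw.
    have -> : g t = g v + (t - v) * (t - w) * (t + v + w - f a)
       + (t - v) * (v ^+ 2 + v * w + w ^+ 2 - f a * (v + w) + f b) by rewrite /g; ring.
    by rewrite gv h1 /t; ring.
  have := nofix _ gt; rewrite /t !eB -(rmorphXn f) aq -/w -/z -vz.
  by rewrite -addrA [- w - v]addrC addrA eqxx.
have sum : v + w + z = f a by apply: vieta; rewrite // eq_sym.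
have zq : z ^+ q = v.
  have gd := gq _ gz; apply/eqP; apply: contraT => dv.
  have dw : z ^+ q != w by apply: contraNneq vz => zw; rewrite (inj_q v z).
  have := vieta _ gd dv dw; rewrite -sum => /addrI dz.
  by have := nofix _ gz; rewrite dz eqxx.
have [x vx] : exists x : L, v = f x.
  by apply: frob_fixed_in; rewrite !expnS expn0 muln1 !exprM -/w -/z zq.
have wx : w = f (x ^+ q) by rewrite /w vx rmorphXn.
have zx : z = f (x ^+ (q ^ 2)) by rewrite /z wx -rmorphXn -exprM.
have fb : f b = v * w + w * z + v * z.
  have h1 := gsub _ _ gv gw vw; rewrite -[LHS](subr0) -{1}h1 -sum; ring.
have fc : f c = v * w * z.
  by rewrite -[LHS](addr0) -{1}gv /g fb -sum; ring.
exists x; split; apply: (fmorph_inj f).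
- by rewrite -sum vx wx zx !rmorphD.
- by rewrite fb vx wx zx !rmorphD !rmorphM.
- by rewrite fc vx wx zx !rmorphM.
Qed.

(** If s <> 1, some X^3 - X^2 + e X - e/s over F_q has no root in F_q, so its roots are x, x^q,
    x^(q^2) with x in L. Then Tr x = 1 and Tr (1/x) = e / (e/s) = s. *)
Lemma Tr_mul_inv_eq (s : L) : s ^+ q = s -> s != 0 ->
  (forall w, w != 0 -> Tr w * Tr w^-1 != s) -> s = 1.
Proof.
move=> sq s0 hs; apply/eqP; apply: contraT => s1.
pose A := [set x : L | x ^+ q == x].
(* [h x] is the only e such that x is a root of X^3 - X^2 + e X - e/s; as h is defined on A minus
   a point, it misses some e in A. *)
pose h (x : L) := (x ^+ 2 - x ^+ 3) / (x - s^-1).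
have sVA : s^-1 \in A by rewrite inE exprVn sq.
have [e eA eh] : exists2 e, e \in A & e \notin [set h x | x in A :\ s^-1].
  apply/subsetPn; apply/negP => /subset_leq_card.
  rewrite leqNgt => /negP; apply; rewrite (cardsD1 s^-1 A) sVA ltnS.
  exact: leq_imset_card.
(* Since 0 is a value of [h], the missed e is nonzero. *)
have h0 : h 0 = 0 by rewrite /h !expr0n subr0 mul0r.
have A0 : 0 \in A :\ s^-1.
  by rewrite !inE [0 == _]eq_sym invr_eq0 s0 expr0n gtn_eqF ?(ltnW q1) //=.
have e0 : e != 0 by apply: contraNneq eh => ->; apply/imsetP; exists 0.
have eq : e ^+ q = e by apply/eqP; rewrite inE in eA.
have := @cubic_conj_roots 1 e (e / s); rewrite expr1n exprMn exprVn eq sq.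
move=> /(_ erefl erefl erefl) [x xq|x [x1 x2 x3]].
  apply/eqP => hx; have [xs|xs] := eqVneq x s^-1.
    have : x ^+ 2 * (x - 1) = 0 by rewrite -[RHS]hx xs; field.
    move/eqP; rewrite mulf_eq0 expf_eq0 xs invr_eq0 (negPf s0) /= subr_eq0 invr_eq1.
    by rewrite (negPf s1).
  move/negP: eh; apply; apply/imsetP; exists x; first by rewrite !inE xs xq eqxx.
  have xs' : x - s^-1 != 0 by rewrite subr_eq0.
  apply: (mulIf xs'); rewrite /h divfK //.
  by apply/eqP; rewrite -subr_eq0 -hx; apply/eqP; ring.
have x0 : x != 0.
  apply: contraNneq e0 => x0; move: x3; rewrite x0 !mul0r => /esym/eqP.
  by rewrite mulf_eq0 invr_eq0 (negPf s0) orbF.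
have := hs x x0; rewrite /Tr3 x1 mul1r !exprVn.
have n0 k : x ^+ k != 0 by rewrite expf_neq0.
have -> : x^-1 + (x ^+ q)^-1 + (x ^+ (q ^ 2))^-1 = e / (e / s).
  by rewrite -x3 -x2; field; rewrite x0 !n0.
by rewrite invf_div mulrC divfK // eqxx.
Qed.

(** At (w, w^q, w^(q^2)) the cubic with coefficients y, y^q, y^(q^2) is N(w) (Tr w Tr (y/w) - r), so
    [no_point_contra] puts y in F_q. Then y factors out of the trace, and [Tr_mul_inv_eq] applies to
    r / y. *)
Theorem Tr_mul_Tr_div (y r : L) : y != 0 -> r ^+ q = r ->
  (forall w, w != 0 -> Tr w * Tr (y / w) != r) -> y ^+ q = y /\ r = y.
Proof.
move=> y0 rq hr.
have r0 : r != 0.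
  by have [w w0 Tw] := Tr0_exists; have := hr w w0; rewrite Tw mul0r eq_sym.
have yq : y ^+ q = y.
  apply/eqP; apply: contraT => yq.
  have y2 : y ^+ (q ^ 2) = (y ^+ q) ^+ q by rewrite -exprM.
  have inj_q (x z : L) : (x ^+ q == z ^+ q) = (x == z).
    by rewrite -subr_eq0 -frobB expf_eq0 subr_eq0 (leq_trans _ q1).
  have n13 : y != y ^+ (q ^ 2) by apply: contraNneq yq => {1}->; rewrite y2 frob3.
  have n23 : y ^+ q != y ^+ (q ^ 2) by rewrite y2 inj_q eq_sym.
  have n12 : y != y ^+ q by rewrite eq_sym.
  exfalso; apply: (no_point_contra L q p m p_prime p_odd m_gt0 qE cardL
    y (y ^+ q) (y ^+ (q ^ 2)) r _ _ _ r0 n12 n13 n23 _ erefl erefl _ _ rq).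
  - exact: y0.
  - by rewrite expf_neq0.
  - by rewrite expf_neq0.
  - by rewrite y2.
  - by rewrite y2 frob3.
  move=> w w0; have wn k : w ^+ k != 0 by rewrite expf_neq0.
  have -> : cubic L y (y ^+ q) (y ^+ (q ^ 2)) r w (w ^+ q) (w ^+ (q ^ 2)) =
      (w * w ^+ q * w ^+ (q ^ 2)) * (Tr w * Tr (y / w) - r).
    by rewrite /cubic /conic /Tr3 !exprMn !exprVn; field; rewrite w0 !wn.
  by rewrite !mulf_neq0 // subr_eq0 hr.
split=> //; apply/esym/eqP; rewrite -subr_eq0; apply/eqP.
have yq2 : y ^+ (q ^ 2) = y by rewrite (exprM y q q) !yq.
have : r / y = 1.
  apply: Tr_mul_inv_eq => [||w w0]; first by rewrite exprMn exprVn rq yq.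
    by rewrite mulf_neq0 ?invr_eq0.
  apply: contraNneq (hr w w0) => h; rewrite -(divfK y0 r) -h /Tr3.
  by rewrite !exprMn yq yq2; apply/eqP; ring.
by move/(congr1 (fun z => z * y)); rewrite divfK // mul1r => ->; rewrite subrr.
Qed.
End TraceCurve.

(** * Planar functions *)

Section Planar.
Variables (p m : nat) (F : finFieldType).
Hypotheses (p_prime : prime p) (p_odd : odd p) (m_gt0 : (0 < m)%N).
Hypothesis cardF : #|F| = ((p ^ m) ^ 3)%N.
Variables (b : 'I_m -> 'I_3 -> F) (a : F).
Hypothesis a0 : a != 0.
Local Notation q := (p ^ m)%N.
Local Notation Tr := (@Tr3 F q).
Local Notation ell := (linpoly p b).

Let q1 : (1 < q)%N := q_gt1 _ _ _ p_prime m_gt0 erefl.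
Let pF : p \in [pchar F] := pcharL _ _ _ _ p_prime erefl cardF.
Let n2 : 2%:R != 0 :> F := two_neq0 _ _ _ _ p_prime p_odd erefl cardF.

Lemma pcharq_nat k : [pchar F].-nat (p ^ k)%N.
Proof. by rewrite pnatX pnatE // pF. Qed.

Lemma ellB x y : ell (x - y) = ell x - ell y.
Proof.
rewrite /linpoly -sumrB; apply: eq_bigr => i _; rewrite -sumrB; apply: eq_bigr => j _.
by rewrite -expnM -expnD exprDn_pchar ?exprNn_pchar ?pcharq_nat // mulrBr.
Qed.

Lemma ell0 : ell 0 = 0.
Proof. by have := ellB 0 0; rewrite !subrr. Qed.

Lemma ellD x y : ell (x + y) = ell x + ell y.
Proof. by rewrite -{1}(opprK y) ellB -(sub0r y) ellB ell0 sub0r opprK. Qed.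

Lemma frobBF (x y : F) : (x - y) ^+ q = x ^+ q - y ^+ q.
Proof. exact: (frobB F q p m p_prime erefl cardF). Qed.
Lemma frobDF (x y : F) : (x + y) ^+ q = x ^+ q + y ^+ q.
Proof. by rewrite exprDn_pchar ?pcharq_nat. Qed.
Lemma frob3F (x : F) : ((x ^+ q) ^+ q) ^+ q = x.
Proof. exact: (frob3 F q cardF). Qed.

Lemma TrE (x : F) : Tr x = x + x ^+ q + (x ^+ q) ^+ q.
Proof. by rewrite /Tr3 -exprM. Qed.
Lemma TrB (x y : F) : Tr (x - y) = Tr x - Tr y.
Proof. by rewrite !TrE !frobBF; ring. Qed.
Lemma Tr_frob (x : F) : Tr x ^+ q = Tr x.
Proof. by rewrite TrE !frobDF frob3F; ring. Qed.

Lemma N3E : N3 q a = a * a ^+ q * (a ^+ q) ^+ q.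
Proof. by rewrite /N3 !exprD expr1 -exprM. Qed.
Lemma N3_neq0 : N3 q a != 0.
Proof. by rewrite /N3 expf_neq0. Qed.

(** This is the map l' of the introduction. *)
Definition nell y := ell (a ^+ (2 * q) * y) / N3 q a.

Lemma nellB x y : nell (x - y) = nell x - nell y.
Proof. by rewrite /nell mulrBr ellB mulrBl. Qed.

Let f (x : F) := Tr3 q (a * x ^+ (q + 1)%N) + ell (x ^+ 2).

(* The substitution x = a^q w, c = a^q z makes the polar form of f independent of a up to the
   factor N(a). *)
Lemma polar_scaled w z :
  f (a ^+ q * w + a ^+ q * z) - f (a ^+ q * w) =
  N3 q a * (Tr w * Tr z - Tr (w * z) + 2%:R * nell (w * z)) + f (a ^+ q * z).
Proof.
have -> : N3 q a * (Tr w * Tr z - Tr (w * z) + 2%:R * nell (w * z)) =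
   N3 q a * (Tr w * Tr z - Tr (w * z)) + ell (2%:R * (a ^+ q * w) * (a ^+ q * z)).
  rewrite mulrDr; congr (_ + _).
  have -> : 2%:R * (a ^+ q * w) * (a ^+ q * z) =
      a ^+ (2 * q) * (w * z) + a ^+ (2 * q) * (w * z) by rewrite mulnC exprM; ring.
  by rewrite ellD /nell; field; exact: N3_neq0.
rewrite /f -[in ell ((_ + _) ^+ 2)]mulrDr.
have -> : (a ^+ q * (w + z)) ^+ 2 = (a ^+ q * w) ^+ 2 + (a ^+ q * z) ^+ 2
   + 2%:R * (a ^+ q * w) * (a ^+ q * z) by ring.
rewrite !ellD.
suff -> : Tr (a * (a ^+ q * w + a ^+ q * z) ^+ (q + 1)) =
   Tr (a * (a ^+ q * w) ^+ (q + 1)) + Tr (a * (a ^+ q * z) ^+ (q + 1))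
   + N3 q a * (Tr w * Tr z - Tr (w * z)) by ring.
rewrite !exprD !expr1 N3E !TrE.
rewrite !(frobDF, exprMn, frob3F).
move: ((w ^+ q) ^+ q) ((z ^+ q) ^+ q) ((a ^+ q) ^+ q) (w ^+ q) (z ^+ q) (a ^+ q) => *.
ring.
Qed.

(** For fixed c, f(x + c) - f(x) is additive in x up to a constant, so it is bijective exactly when
    the additive part has trivial kernel. *)
Lemma planarP : planar f <->
  (forall w z, w != 0 -> z != 0 -> Tr w * Tr z - Tr (w * z) + 2%:R * nell (w * z) != 0).
Proof.
have aq0 : a ^+ q != 0 by rewrite expf_neq0.
have scal x : x = a ^+ q * (x / a ^+ q) by rewrite mulrC divfK.
have f0 : f 0 = 0.
  rewrite /f !expr0n /= addn1 mulr0 ell0 addr0 TrE !expr0n gtn_eqF ?(ltnW q1) //.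
  by rewrite expr0n gtn_eqF ?(ltnW q1) // !addr0.
split=> [pl w z w0 z0|h c c0].
  apply/eqP => h; have /bij_inj inj := pl (a ^+ q * z) (mulf_neq0 aq0 z0).
  have /eqP : a ^+ q * w = 0.
    by apply: inj; rewrite polar_scaled h mulr0 !add0r f0 subr0.
  by rewrite mulf_eq0 (negPf aq0) (negPf w0).
apply: injF_bij => x y; rewrite (scal c) (scal x) (scal y) !polar_scaled.
move: (c / _) (x / _) (y / _) (mulf_neq0 c0 (invr_neq0 aq0)) => z w w' z0 /addIr.
move/(mulfI N3_neq0) => e; congr (_ * _); apply/eqP; rewrite -subr_eq0.
apply: contraT => w0; have := h _ _ w0 z0.
rewrite TrB !mulrBl TrB nellB => /eqP; case.
move/eqP: e; rewrite -subr_eq0 => /eqP e; rewrite -[RHS]e; ring.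
Qed.

Definition base : {set F} := [set y | y ^+ q == y].

Lemma card_image_trace0 (g : F -> F) : (forall y, Tr (g y) = 0) ->
  (#|[set g y | y : F]| <= q ^ 2)%N.
Proof.
move=> hg; pose P : {poly F} := 'X^(q ^ 2) + ('X^q + 'X).
have sP1 : size ('X^q + 'X : {poly F}) = q.+1.
  by rewrite size_polyDl ?size_polyXn // size_polyX.
have sP : size P = (q ^ 2).+1.
  by rewrite size_polyDl ?size_polyXn // sP1 ltnS; have := q1; nia.
rewrite cardE -ltnS -sP; apply: max_poly_roots; rewrite ?enum_uniq //.
  by rewrite -size_poly_gt0 sP.
apply/allP => t; rewrite mem_enum => /imsetP[y _ ->].
by rewrite /root !(hornerE, horner_exp) /= -[X in _ == X](hg y) /Tr3; apply/eqP; ring.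
Qed.

(** With [s] choosing preimages, y goes injectively to its image and a kernel element, whence q^3 <=
    q^2 |U|. *)
Lemma card_kernel (g : F -> F) : (forall x y, g (x - y) = g x - g y) ->
  (forall y, Tr (g y) = 0) -> (q <= #|[set y | g y == 0%R]|)%N.
Proof.
move=> gB hg; set U := [set y | _]; set I := [set g y | y : F].
pose s t := odflt 0 [pick y | g y == t].
have gs y : g (s (g y)) = g y.
  by rewrite /s; case: pickP => [x /eqP //|/(_ y)]; rewrite eqxx.
have inj : injective (fun y => (g y, y - s (g y))).
  by move=> x y [gxy]; rewrite gxy => /addIr.
pose J := [set (g y, y - s (g y)) | y : F].
have : (#|J| <= #|setX I U|)%N.
  apply/subset_leq_card/subsetP => _ /imsetP[y _ ->].
  by rewrite inE /= imset_f // inE gB gs subrr eqxx.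
have := card_image_trace0 g hg; rewrite -/I /J (card_imset _ inj) cardsX cardF.
by have := q1; nia.
Qed.

Definition base_coef (i : 'I_m) : F := \sum_(j < 3) b i j * a ^+ (2 * p ^ i * q ^ j.+1).

(** On F_q every y^(q^j) is y, so the three terms with the same i combine. *)
Lemma ell_base y : y ^+ q = y -> ell (a ^+ (2 * q) * y) = \sum_i base_coef i * y ^+ (p ^ i).
Proof.
move=> yq; rewrite /linpoly; apply: eq_bigr => i _; rewrite mulr_suml; apply: eq_bigr => j _.
have yqk k : y ^+ (q ^ k) = y by elim: k => [|k IH]; rewrite ?expr1 // expnS exprM yq.
rewrite exprMn [X in _ * (_ * y ^+ X)]mulnC (exprM y) yqk -exprM mulrA expnS.
by congr (_ * _ ^+ _ * _); lia.
Qed.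

(** On F_q, ell(a^(2q) y) - N(a) y is a polynomial in y of degree below q with at least q zeros,
    hence zero, and the exponents p^i are distinct. *)
Lemma base_coef_of_nell : (q <= #|base|)%N -> (forall y, y ^+ q = y -> nell y = y) ->
  forall i : 'I_m, base_coef i = if (i == 0 :> nat)%N then N3 q a else 0.
Proof.
move=> cb hn i; pose P : {poly F} := \sum_i base_coef i *: 'X^(p ^ i) - N3 q a *: 'X.
have p1 : (1 < p)%N by apply: prime_gt1.
have P0 : P = 0.
  apply/eqP; apply: contraT => Pn0.
  have sP : (size P <= q)%N.
    apply: leq_trans (size_polyD _ _) _; rewrite geq_max size_polyN; apply/andP; split.
      apply: leq_trans (size_sum _ _ _) _; apply/bigmax_leqP => k _.
      by rewrite (leq_trans (size_scale_leq _ _)) // size_polyXn ltn_exp2l.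
    by rewrite (leq_trans (size_scale_leq _ _)) // size_polyX.
  have : (size (enum base) < size P)%N.
    apply: max_poly_roots => //; last by rewrite enum_uniq.
    apply/allP => y; rewrite mem_enum inE => /eqP yq.
    rewrite /root /P !hornerE horner_sum.
    under eq_bigr do rewrite hornerZ hornerXn.
    rewrite -ell_base // -{2}(hn _ yq) /nell [N3 _ _ * _]mulrC divfK ?subrr //.
    exact: N3_neq0.
  by rewrite -cardE ltnNge (leq_trans sP).
have := congr1 (fun P : {poly F} => P`_(p ^ i)) P0.
rewrite coef0 coefB coefZ coefX coef_sum (bigD1 i) //= coefZ coefXn eqxx mulr1.
rewrite big1 ?addr0 => [|k ki]; last first.
  by rewrite coefZ coefXn eqn_exp2l // [(_ == _ :> nat)]eq_sym (inj_eq val_inj) (negPf ki) mulr0.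
have -> : (p ^ i == 1)%N = (i == 0 :> nat)%N by rewrite -[1%N](expn0 p) eqn_exp2l.
by move/eqP; rewrite subr_eq0 => /eqP ->; case: eqP => _; rewrite ?mulr1 ?mulr0.
Qed.

Lemma nell_of_base_coef : (forall i : 'I_m, base_coef i = if (i == 0 :> nat)%N then N3 q a else 0) ->
  forall y, y ^+ q = y -> nell y = y.
Proof.
move=> hc y yq; rewrite /nell ell_base // (bigD1 (Ordinal m_gt0)) //= hc /= expr1.
rewrite big1 ?addr0 => [|i i0]; last by rewrite hc -[(_ == 0)%N]/(i == Ordinal m_gt0) (negPf i0) mul0r.
by rewrite [N3 _ _ * _]mulrC mulfK // N3_neq0.
Qed.

Theorem planar_iff : planar f <-> bijective ell /\
  forall i : 'I_m, base_coef i = if (i == 0 :> nat)%N then N3 q a else 0.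
Proof.
rewrite planarP; split=> [h|[bij /nell_of_base_coef hn] w z w0 z0]; last first.
  apply/eqP => e; set y := w * z in e.
  have yN : 2%:R * nell y = Tr y - Tr w * Tr z.
    by apply/eqP; rewrite -subr_eq0; apply/eqP; rewrite -[RHS]e; ring.
  have nq : nell y ^+ q = nell y.
    apply: (mulfI n2); have <- : 2%:R ^+ q = 2%:R :> F.
      by rewrite (frobDF 1 1) expr1n.
    by rewrite -exprMn {1}yN frobBF exprMn !Tr_frob -yN (frobDF 1 1) expr1n.
  (* As l'(y) lies in F_q, l' fixes it; so y and l'(y) have the same image under l', which is
     injective along with [ell]. *)
  have yy : y = nell y.
    have : a ^+ (2 * q) * y = a ^+ (2 * q) * nell y.
      apply: (bij_inj bij); have := hn _ nq; rewrite {1}/nell => /(congr1 (fun t => t * N3 q a)).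
      by rewrite divfK ?N3_neq0 // => ->; rewrite /nell divfK // N3_neq0.
    by move/(mulfI (expf_neq0 _ a0)).
  have yq : y ^+ q = y by rewrite yy.
  have y0 : y != 0 by rewrite mulf_neq0.
  have zE : z = y * w^-1 by rewrite /y mulrAC divff // mul1r.
  clearbody y.
  (* For z = y/w with y in F_q this is N(w) times the vanishing expression, in which - Tr y + 2
     l'(y) = - y. *)
  have : y * ((w + w ^+ q) * (w ^+ q + (w ^+ q) ^+ q) * (w + (w ^+ q) ^+ q)) = 0.
    have wn : w ^+ q != 0 by rewrite expf_neq0.
    have wn2 : (w ^+ q) ^+ q != 0 by rewrite expf_neq0.
    apply: (@etrans _ _ (w * w ^+ q * (w ^+ q) ^+ q * (Tr w * Tr z - Tr y + 2%:R * nell y))).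
      rewrite -yy !TrE zE !exprMn !exprVn !yq.
      move: wn wn2; move: (w ^+ q) ((w ^+ q) ^+ q) => w' w'' w'0 w''0.
      by field; rewrite w''0 w'0 w0.
    by rewrite [X in _ * X = _]e mulr0.
  (* From x^q = - x would follow x = x^(q^3) = - x. *)
  have wne x : x != 0 -> x + x ^+ q != 0 :> F.
    move=> x0; rewrite addrC addr_eq0; apply/eqP => xq.
    have xN : (- x) ^+ q = x.
      by rewrite -[- x]sub0r frobBF xq expr0n gtn_eqF ?(ltnW q1) // sub0r opprK.
    have : x = - x by rewrite -{1}(frob3F x) xq xN.
    move/eqP; rewrite -subr_eq0 opprK -mulr2n -mulr_natl mulf_eq0 (negPf n2) (negPf x0).
    by [].
  apply/eqP; rewrite !mulf_neq0 ?wne ?expf_neq0 //.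
  have := wne ((w ^+ q) ^+ q); rewrite frob3F addrC; apply.
  by rewrite !expf_neq0.
(* For z = y/w, planarity says that Tr w Tr (y/w) avoids Tr y - 2 l'(y), an element of F_q. *)
have key y : y != 0 -> nell y ^+ q = nell y -> y ^+ q = y /\ nell y = y.
  move=> y0 nq; have [||yq e] := Tr_mul_Tr_div F q p m p_prime p_odd m_gt0 erefl cardF
    y (Tr y - 2%:R * nell y) y0.
  - by rewrite frobBF Tr_frob exprMn nq (frobDF 1 1) expr1n.
  - move=> w w0; have := h w (y / w) w0; rewrite mulf_neq0 ?invr_neq0 // => /(_ isT).
    rewrite mulrCA mulfV // mulr1; apply: contraNneq => ->; apply/eqP; ring.
  split=> //; apply: (mulfI n2); rewrite TrE !yq in e.
  apply/eqP; rewrite -subr_eq0; apply/eqP.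
  by rewrite -[RHS](subrr y) -[X in _ = _ - X]e; ring.
have nell0 : nell 0 = 0 by have := nellB 0 0; rewrite !subrr.
(* The values of l'^q - l' have trace zero, so its kernel U has at least q elements. By [key] they
   are fixed points of l' in F_q, which has at most q elements, so l' fixes all of F_q. *)
pose U := [set y | nell y ^+ q - nell y == 0].
have cU : (q <= #|U|)%N.
  apply: card_kernel => [x y|y]; first by rewrite nellB frobBF; ring.
  by rewrite TrB TrE frob3F [X in _ - X]TrE; ring.
have subU : U \subset [set y in base | nell y == y].
  apply/subsetP => y; rewrite !inE subr_eq0 => /eqP nq.
  have [->|y0] := eqVneq y 0; first by rewrite nell0 expr0n gtn_eqF ?(ltnW q1) // !eqxx.
  by have [-> ->] := key y y0 nq; rewrite !eqxx.
have base_le : (#|base| <= q)%N.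
  pose P : {poly F} := 'X^q - 'X.
  have sP : size P = q.+1 by rewrite size_polyDl ?size_polyXn // size_polyN size_polyX.
  rewrite cardE -ltnS -sP; apply: max_poly_roots; rewrite ?enum_uniq //.
    by rewrite -size_poly_gt0 sP.
  apply/allP => t; rewrite mem_enum inE => /eqP tq.
  by rewrite /root !(hornerE, horner_exp) tq subrr.
have subB : [set y in base | nell y == y] \subset base.
  by apply/subsetP => y; rewrite inE => /andP[].
have UE : [set y in base | nell y == y] = base.
  apply/eqP; rewrite eqEcard subB (leq_trans base_le) // (leq_trans cU) //.
  exact: subset_leq_card subU.
have nbase y : y ^+ q = y -> nell y = y.
  move=> yq; have : y \in base by rewrite inE yq.
  by rewrite -UE inE => /andP[_ /eqP].
have cb : (q <= #|base|)%N by rewrite -UE (leq_trans cU) // subset_leq_card.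
split; last exact: base_coef_of_nell.
(* A nonzero kernel element of [ell], rescaled, gives t <> 0 with l'(t) = 0 in F_q, whereas [key]
   gives l'(t) = t. *)
apply: injF_bij => x y xy; apply/eqP; rewrite -subr_eq0; apply: contraT => xy0.
have aq0 : a ^+ (2 * q) != 0 by rewrite expf_neq0.
pose t := (x - y) / a ^+ (2 * q).
have t0 : t != 0 by rewrite mulf_neq0 ?invr_neq0.
have nt : nell t = 0 by rewrite /nell /t [a ^+ _ * _]mulrC divfK // ellB xy subrr mul0r.
have [|_ tE] := key t t0; first by rewrite nt expr0n gtn_eqF ?(ltnW q1).
by rewrite -tE nt eqxx in t0.
Qed.
End Planar.

Theorem theorem2p7 (p m : nat) (F : finFieldType)
  (hp : prime p) (hodd : odd p) (hm : (0 < m)%N)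
  (hF : #|F| = ((p ^ m) ^ 3)%N)
  (b : 'I_m -> 'I_3 -> F) (a : F) (ha : a != 0) :
  planar (fun x : F => Tr3 (p ^ m) (a * x ^+ (p ^ m + 1)%N)
                        + linpoly p b (x ^+ 2))
  <->
  (bijective (linpoly p b) /\
   forall i : 'I_m,
     \sum_(j < 3) b i j * a ^+ (2 * p ^ i * (p ^ m) ^ j.+1)%N
       = if (nat_of_ord i == 0)%N then N3 (p ^ m) a else 0).
Proof. exact: planar_iff. Qed.
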